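(* Suppose $(X, \| \cdot \|)$ is a separable Benyamini space. Then, for any $c > 1$, $X$ can be equipped with an equivalent norm $||| \cdot |||$ such that $\| x \| \leq ||| x ||| \leq c^2\| x \|$ for all $x \in X$, and such that the identity is the only lattice isometry on $(X, ||| \cdot |||)$. If $X$ has no more than one atom, then $||| \cdot |||$ can be selected to be an AM-norm.
   Context: All spaces are over the real scalars. A lattice isometry is a surjective linear isometry of the space onto itself preserving the lattice operations. A lattice norm is an AM-norm if $\| x \vee y \| = \max\{ \|x\|, \|y\| \}$ for all positive $x,y$. An atom is a positive nonzero element $e$ such that $0 \le x \le e$ implies that $x$ is a scalar multiple of $e$; atoms are counted up to positive scalar multiples (i.e. one counts normalized atoms). A Benyamini space is a $C$-Benyamini space for some constant $C>1$, where a Banach lattice $X$ is a $C$-Benyamini space if it is a (closed) sublattice of $C(K)$ with the sup norm, where: (1) $K$ is the one point compactification of the (topological) union of mutually disjoint compact Hausdorff sets $K_n$, $n \in \mathbb{N}$ (so $K = (\bigcup_n K_n) \cup \{\infty\}$); (2) every $x \in X$ vanishes at $\infty$; (3) $X$ separates points of each $K_n$ (for all distinct $t,s\in K_n$, there exists $x \in X$ with $x(t) \neq x(s)$); (4) if $t \in K_m$, $s \in K_n$, and $\lambda$ is a fixed scalar such that $x(t) = \lambda x(s)$ for all $x \in X$, then $\lambda = C^{n-m}$. *)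

(* Defs.v *)
From HB Require Import structures.
From mathcomp Require Import all_boot all_order all_algebra.
From mathcomp Require Import all_classical all_reals all_analysis.

Set Implicit Arguments.
Unset Strict Implicit.
Unset Printing Implicit Defensive.

Import Order.TTheory GRing.Theory Num.Theory.
Import numFieldNormedType.Exports.

Local Open Scope classical_set_scope.
Local Open Scope ring_scope.

(* A vector lattice of real functions on [K] is a set [X : set (K -> R)] with
   the pointwise operations and order; a norm on it is a total function
   [N : (K -> R) -> R] of which only the values on [X] matter, and likewise an
   operator on it is a total map [T] restricted to [X]. *)

Section FunctionLattices.
Context {R : realType} {K : Type}.
Implicit Types (X D : set (K -> R)) (N : (K -> R) -> R).

Definition fun_le (x y : K -> R) : Prop := forall t, x t <= y t.

Definition fun_abs (x : K -> R) : K -> R := fun t => `|x t|.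

Definition vector_sublattice X : Prop :=
  [/\ X 0,
      forall x y, X x -> X y -> X (x + y),
      forall (a : R) x, X x -> X (a *: x)
    & forall x y, X x -> X y -> X (x \max y) /\ X (x \min y)].

Definition is_norm X N : Prop :=
  [/\ forall x y, X x -> X y -> N (x + y) <= N x + N y,
      forall (a : R) x, X x -> N (a *: x) = `|a| * N x
    & forall x, X x -> N x = 0 -> x = 0].

Definition is_lattice_norm X N : Prop :=
  is_norm X N /\
  forall x y, X x -> X y -> fun_le (fun_abs x) (fun_abs y) -> N x <= N y.

Definition is_AM_norm X N : Prop :=
  is_lattice_norm X N /\
  forall x y, X x -> X y -> fun_le 0 x -> fun_le 0 y ->
    N (x \max y) = Num.max (N x) (N y).

Definition lattice_isometry X N (T : (K -> R) -> (K -> R)) : Prop :=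
  [/\ T @` X = X,
      forall (a : R) x y, X x -> X y -> T (a *: x + y) = a *: T x + T y,
      forall x y, X x -> X y ->
        T (x \max y) = T x \max T y /\ T (x \min y) = T x \min T y
    & forall x, X x -> N (T x) = N x].

Definition only_trivial_lattice_isometry X N : Prop :=
  forall T, lattice_isometry X N T -> forall x, X x -> T x = x.

Definition atom X (e : K -> R) : Prop :=
  [/\ X e, fun_le 0 e, e <> 0
    & forall x, X x -> fun_le 0 x -> fun_le x e -> exists a : R, x = a *: e].

(* Atoms are counted up to positive scalar multiples. *)
Definition at_most_one_atom X : Prop :=
  forall e f, atom X e -> atom X f -> exists2 a : R, 0 < a & f = a *: e.

(* [sup] of an unbounded set is 0; used only for continuous functions on a
   nonempty compact space, where the set is nonempty and bounded. *)
Definition sup_norm (x : K -> R) : R := sup [set `|x t| | t in [set: K]].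

Definition norm_closure N D : set (K -> R) :=
  [set x | forall eps : R, 0 < eps -> exists2 y, D y & N (x - y) < eps].

Definition separable X N : Prop :=
  exists D, [/\ countable D, D `<=` X & X `<=` norm_closure N D].

End FunctionLattices.

Section Benyamini.
Context {R : realType}.

Definition benyamini_compactum (K_ : nat -> topologicalType) : topologicalType :=
  one_point_compactification {n & K_ n}.

Definition pt (K_ : nat -> topologicalType) (n : nat) (t : K_ n) :
  benyamini_compactum K_ := Some (existT _ n t).

Definition infty (K_ : nat -> topologicalType) : benyamini_compactum K_ := None.

Definition closed_sublattice_of_C (K : topologicalType) (X : set (K -> R)) :=
  [/\ forall x, X x -> continuous x,
      vector_sublattice X
    & forall x, continuous x -> norm_closure sup_norm X x -> X x].

(* In the last clause the exponent is a difference of integers, [C ^ (n - m)]. *)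
Definition C_Benyamini (C : R) (K_ : nat -> topologicalType)
    (X : set (benyamini_compactum K_ -> R)) : Prop :=
  [/\ forall n, compact [set: K_ n] /\ hausdorff_space (K_ n),
      closed_sublattice_of_C X,
      forall x, X x -> x (infty K_) = 0,
      forall n (t s : K_ n), t <> s -> exists2 x, X x & x (pt t) <> x (pt s)
    & forall m n (t : K_ m) (s : K_ n) (lambda : R),
        (forall x, X x -> x (pt t) = lambda * x (pt s)) ->
        lambda = C ^ (n%:Z - m%:Z)].

Definition Benyamini (K_ : nat -> topologicalType)
    (X : set (benyamini_compactum K_ -> R)) : Prop :=
  exists2 C : R, 1 < C & C_Benyamini C X.

End Benyamini.

(* Main.v *)
Require Import Defs.
From mathcomp Require Import all_boot all_order all_algebra.
From mathcomp Require Import all_classical all_reals all_analysis.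
From mathcomp Require Import ring lra.

Set Implicit Arguments.
Unset Strict Implicit.
Unset Printing Implicit Defensive.

Import Order.TTheory GRing.Theory Num.Theory.
Import numFieldNormedType.Exports.

Local Open Scope classical_set_scope.
Local Open Scope ring_scope.

(** Choose a dense sequence [g_n] in [X], a point [t_n] where [|g_n|] attains its
    maximum, and keep one [t_n] for each functional [x |-> x (t_n)] on [X]. The
    resulting lattice homomorphisms [f_i] are norming and pairwise
    non-proportional; hence cutting a positive [x] down to [x /\ M z] kills any
    finitely many [f_j] at [x] without changing [f_i x].

    AM case: take [N x = sup_i w_i |f_i x|] with weights [w_i > 1] tending to 1.
    Near its peak at [f_i], a positive [x] with [w_i f_i x = 1] cannot be made
    smaller than [a_i / w_i], where [a_i] is the corresponding quantity for the
    sup norm: the finitely many heavier weights can be cut away. This ratio is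
    defined from the lattice norm alone, and a norm-one homomorphism for which it
    is less than 1 must be some [w_k f_k]. An isometry therefore permutes the
    [w_i f_i] preserving [a_i / w_i]; for generic weights these ratios are
    distinct, except that [a_i = 0] is possible when [f_i] sits at an atom.

    General case: take [N x = sup |x| + F x] with [F x = sum_i d_i |f_i x|] and
    distinct [d_i]. For [x, u >= 0] disjoint with [u] large,
    [N (u + x) - N u = F x]. So an isometry preserves the infimum [d_i] of [F x]
    over such [x] with [f_i x = 1], as well as the infimum [1 + d_i] of [N x].
    It maps [f_i] to a multiple [b f_k]; scaling gives [b d_i = d_k] and
    [b (1 + d_i) = 1 + d_k], whence [b = 1] and [k = i]. *)

(** * Function sublattices, lattice homomorphisms and lattice isometries *)

Section SublatticeTheory.
Context {R : realType} {K : Type} {X : set (K -> R)} (hX : vector_sublattice X).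
Implicit Types (x y z : K -> R) (g h : (K -> R) -> R).

Lemma sublattice0 : X 0.
Proof. by case: hX. Qed.

Lemma sublatticeD x y : X x -> X y -> X (x + y).
Proof. by case: hX => _ + _ _; exact. Qed.

Lemma sublatticeZ (a : R) x : X x -> X (a *: x).
Proof. by case: hX => _ _ + _; exact. Qed.

Lemma sublattice_max x y : X x -> X y -> X (x \max y).
Proof. by case: hX => _ _ _ /[apply] /[apply] -[]. Qed.

Lemma sublattice_min x y : X x -> X y -> X (x \min y).
Proof. by case: hX => _ _ _ /[apply] /[apply] -[]. Qed.

Lemma sublatticeN x : X x -> X (- x).
Proof. by rewrite -scaleN1r; exact: sublatticeZ. Qed.

Lemma sublatticeB x y : X x -> X y -> X (x - y).
Proof. by move=> Xx Xy; apply: sublatticeD => //; exact: sublatticeN. Qed.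

Lemma fun_absE x : fun_abs x = x \max (- x).
Proof. by apply/funext => t; rewrite /= maxrN. Qed.

Lemma sublattice_abs x : X x -> X (fun_abs x).
Proof. by move=> Xx; rewrite fun_absE; apply: sublattice_max => //; exact: sublatticeN. Qed.

Lemma fun_abs_ge0 x : fun_le 0 (fun_abs x).
Proof. by move=> t; exact: normr_ge0. Qed.

Lemma fun_abs_id x : fun_le 0 x -> fun_abs x = x.
Proof. by move=> x0; apply/funext => t; rewrite /fun_abs ger0_norm //; exact: x0. Qed.

Lemma fun_max_r x y : fun_le x y -> x \max y = y.
Proof. by move=> xy; apply/funext => t /=; apply: max_r; exact: xy. Qed.

Lemma fun_le_trans x y z : fun_le x y -> fun_le y z -> fun_le x z.
Proof. by move=> xy yz t; exact: le_trans (xy t) (yz t). Qed.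

(* Only the values of [h] on [X] are constrained, and [h = 0] is allowed. *)
Definition lattice_hom h : Prop :=
  [/\ forall (a : R) x y, X x -> X y -> h (a *: x + y) = a * h x + h y,
      forall x y, X x -> X y -> h (x \max y) = Num.max (h x) (h y)
    & forall x y, X x -> X y -> h (x \min y) = Num.min (h x) (h y)].

Section Hom.
Context {h : (K -> R) -> R} (hh : lattice_hom h).

Lemma homZD (a : R) x y : X x -> X y -> h (a *: x + y) = a * h x + h y.
Proof. by case: hh => + _ _; exact. Qed.

Lemma hom0 : h 0 = 0.
Proof.
have := homZD (-1) sublattice0 sublattice0.
by rewrite scaler0 addr0 mulN1r addNr.
Qed.

Lemma homD x y : X x -> X y -> h (x + y) = h x + h y.
Proof. by move=> Xx Xy; have := homZD 1 Xx Xy; rewrite scale1r mul1r. Qed.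

Lemma homZ (a : R) x : X x -> h (a *: x) = a * h x.
Proof. by move=> Xx; have := homZD a Xx sublattice0; rewrite addr0 hom0 addr0. Qed.

Lemma homN x : X x -> h (- x) = - h x.
Proof. by move=> Xx; rewrite -scaleN1r homZ // mulN1r. Qed.

Lemma homB x y : X x -> X y -> h (x - y) = h x - h y.
Proof. by move=> Xx Xy; rewrite homD ?homN //; exact: sublatticeN. Qed.

Lemma hom_max x y : X x -> X y -> h (x \max y) = Num.max (h x) (h y).
Proof. by case: hh => _ + _; exact. Qed.

Lemma hom_min x y : X x -> X y -> h (x \min y) = Num.min (h x) (h y).
Proof. by case: hh => _ _; exact. Qed.

Lemma hom_abs x : X x -> h (fun_abs x) = `|h x|.
Proof.
move=> Xx; rewrite fun_absE hom_max ?homN ?maxrN //.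
exact: sublatticeN.
Qed.

Lemma hom_le x y : X x -> X y -> fun_le x y -> h x <= h y.
Proof. by move=> Xx Xy /fun_max_r xy; rewrite -xy hom_max // le_max lexx. Qed.

Lemma hom_ge0 x : X x -> fun_le 0 x -> 0 <= h x.
Proof. by move=> Xx x0; rewrite -hom0; apply: hom_le => //; exact: sublattice0. Qed.

End Hom.

Lemma fun_le0Z (a : R) x : 0 <= a -> fun_le 0 x -> fun_le 0 (a *: x).
Proof. by move=> a0 x0 t; exact/mulr_ge0/x0. Qed.

(** With [M = h x / h z], the multiple [M *: z] takes the value [h x] under [h] and 0 under [g], so
    [x \min (M *: z)] is the required cut. *)
Lemma hom_cut g h x z : lattice_hom g -> lattice_hom h -> X x -> fun_le 0 x ->
  X z -> fun_le 0 z -> g z = 0 -> 0 < h z ->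
  exists y, [/\ X y, fun_le 0 y, fun_le y x, h y = h x & g y = 0].
Proof.
move=> hg hh Xx x0 Xz z0 gz hz; set M := h x / h z.
have M0 : 0 <= M by rewrite divr_ge0 ?(hom_ge0 hh) ?ltW.
have XMz : X (M *: z) by exact: sublatticeZ.
exists (x \min (M *: z)); split; first exact: sublattice_min.
- by move=> t; rewrite /= le_min x0 (fun_le0Z M0 z0).
- by move=> t; rewrite /= ge_min lexx.
- by rewrite (hom_min hh) // (homZ hh) // /M divfK ?gt_eqF // minxx.
- by rewrite (hom_min hg) // (homZ hg) // gz mulr0 min_r ?(hom_ge0 hg).
Qed.

(** Successive cuts only decrease a positive element, so the zeros already obtained persist. The
    predicate [S] exempts indices, such as that of [h] itself when [h] is one of the [f k]. *)
Lemma hom_cut_finite (f : nat -> (K -> R) -> R) h (S : nat -> Prop) n x :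
  (forall k, lattice_hom (f k)) -> lattice_hom h -> X x -> fun_le 0 x ->
  (forall k, S k -> exists z, [/\ X z, fun_le 0 z, f k z = 0 & 0 < h z]) ->
  exists y, [/\ X y, fun_le 0 y, fun_le y x, h y = h x
    & forall k, (k < n)%N -> S k -> f k y = 0].
Proof.
move=> hf hh Xx x0 sep; elim: n => [|n [y [Xy y0 yx hy fy]]].
  by exists x; split => // t.
have [Sn|nSn] := pselect (S n); last first.
  exists y; split => // k; rewrite ltnS leq_eqVlt => /orP[/eqP ->|]; [by []|exact: fy].
have [z [Xz z0 fz hz]] := sep _ Sn.
have [u [Xu u0 uy hu fu]] := hom_cut (hf n) hh Xy y0 Xz z0 fz hz.
exists u; split => //; first exact: fun_le_trans uy yx.
  by rewrite hu.
move=> k; rewrite ltnS leq_eqVlt => /orP[/eqP -> //|kn Sk].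
apply/le_anti; rewrite (hom_ge0 (hf k)) // andbT -(fy _ kn Sk).
exact: (hom_le (hf k)).
Qed.

(** The remainder [x - g x *: p] lies in the kernel of [g], and so does its absolute value, which is
    positive; hence [h] kills it. *)
Lemma hom_proportional g h p : lattice_hom g -> lattice_hom h ->
  X p -> g p = 1 -> (forall z, X z -> fun_le 0 z -> g z = 0 -> h z = 0) ->
  forall x, X x -> h x = h p * g x.
Proof.
move=> hg hh Xp gp ker x Xx.
have XZ := sublatticeZ (g x) Xp.
have Xz : X (x - g x *: p) by exact: sublatticeB.
have : h (fun_abs (x - g x *: p)) = 0.
  apply: ker; [exact: sublattice_abs|exact: fun_abs_ge0|].
  by rewrite (hom_abs hg) // (homB hg) // (homZ hg) // gp mulr1 subrr normr0.
rewrite (hom_abs hh) // (homB hh) // (homZ hh) // => /normr0_eq0 /eqP.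
by rewrite subr_eq0 => /eqP ->; rewrite mulrC.
Qed.

Section Isometry.
Context {N : (K -> R) -> R} (nN : is_norm X N).
Context {T : (K -> R) -> K -> R} (isoT : lattice_isometry X N T).

Lemma iso_in x : X x -> X (T x).
Proof. by case: isoT => TX _ _ _ Xx; rewrite -TX; exists x. Qed.

Lemma iso_onto y : X y -> exists2 x, X x & T x = y.
Proof. by case: isoT => TX _ _ _; rewrite -{1}TX. Qed.

Lemma isoZD (a : R) x y : X x -> X y -> T (a *: x + y) = a *: T x + T y.
Proof. by case: isoT => _ + _ _; exact. Qed.

Lemma iso0 : T 0 = 0.
Proof.
have := isoZD (-1) sublattice0 sublattice0.
by rewrite !scaleN1r !addNr.
Qed.

Lemma isoD x y : X x -> X y -> T (x + y) = T x + T y.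
Proof. by move=> Xx Xy; have := isoZD 1 Xx Xy; rewrite !scale1r. Qed.

Lemma iso_max x y : X x -> X y -> T (x \max y) = T x \max T y.
Proof. by case: isoT => _ _ + _ => /[apply] /[apply] -[]. Qed.

Lemma iso_min x y : X x -> X y -> T (x \min y) = T x \min T y.
Proof. by case: isoT => _ _ + _ => /[apply] /[apply] -[]. Qed.

Lemma iso_norm x : X x -> N (T x) = N x.
Proof. by case: isoT => _ _ _; exact. Qed.

(** Injectivity comes from the norm: if [T] kills the difference, the difference has norm 0. *)
Lemma iso_inj x y : X x -> X y -> T x = T y -> x = y.
Proof.
move=> Xx Xy Txy; have XB : X ((-1) *: x + y).
  by apply: sublatticeD => //; exact: sublatticeZ.
have NT0 : N (T ((-1) *: x + y)) = 0.
  rewrite isoZD // Txy scaleN1r addNr.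
  case: nN => _ NZ _; have := NZ 0 0 sublattice0.
  by rewrite scale0r normr0 mul0r.
case: nN => _ _ /(_ _ XB); rewrite -iso_norm // => /(_ NT0).
by rewrite scaleN1r addrC => /eqP; rewrite subr_eq0 => /eqP.
Qed.

(** The order is encoded as [x \max y = y], an identity that passes through [T] and, by injectivity,
    back. *)
Lemma iso_le x y : X x -> X y -> fun_le x y <-> fun_le (T x) (T y).
Proof.
move=> Xx Xy; split => [/fun_max_r xy t|/fun_max_r xy t].
  by rewrite -xy iso_max //= le_max lexx.
rewrite -(iso_inj (sublattice_max Xx Xy) Xy) /= ?le_max ?lexx //.
by rewrite iso_max.
Qed.

Lemma iso_ge0 x : X x -> fun_le 0 x <-> fun_le 0 (T x).
Proof. by move=> Xx; rewrite -{2}iso0; apply: iso_le => //; exact: sublattice0. Qed.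

Lemma hom_iso h : lattice_hom h -> lattice_hom (h \o T).
Proof.
move=> hh; split=> [a x y Xx Xy|x y Xx Xy|x y Xx Xy] /=.
- by rewrite isoZD //; case: hh => + _ _; apply; exact: iso_in.
- by rewrite iso_max // (hom_max hh) //; exact: iso_in.
- by rewrite iso_min // (hom_min hh) //; exact: iso_in.
Qed.

End Isometry.
End SublatticeTheory.
Arguments lattice_hom {R K} X h.

(** * Powers of one half *)

Lemma exp_half_lt (R : realType) (e : R) : 0 < e -> exists n, 2^-1 ^+ n < e.
Proof.
move=> e0; have /archi_boundP : 0 <= e^-1 by rewrite invr_ge0 ltW.
set n := Num.Def.archi_bound _ => en; exists n.
rewrite exprVn invf_plt ?posrE ?exprn_gt0 //.
by apply: lt_trans en _; rewrite -natrX ltr_nat ltn_expl.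
Qed.

Lemma exp_half_ge0 (R : realType) n : 0 <= (2^-1 : R) ^+ n.
Proof. by rewrite exprn_ge0. Qed.

Lemma exp_half_anti (R : realType) m n : (m <= n)%N ->
  (2^-1 : R) ^+ n <= 2^-1 ^+ m.
Proof. by move=> mn; apply: ler_wiXn2l => //; rewrite ?invr_ge0 ?invf_le1 ?ler1n. Qed.

(** * The sup norm on a lattice of bounded functions *)

Section SupNorm.
Context {R : realType} {K : Type} {X : set (K -> R)} (hX : vector_sublattice X).
Context (t0 : K) (bX : forall x, X x -> exists M : R, forall t, `|x t| <= M).
Implicit Types (x y z : K -> R).

Lemma ler_sup_norm x t : X x -> `|x t| <= sup_norm x.
Proof.
move=> /bX[M xM]; apply: ub_le_sup; last by exists t.
by exists M => _ [s _ <-].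
Qed.

Lemma sup_norm_ler x M : (forall t, `|x t| <= M) -> sup_norm x <= M.
Proof.
by move=> xM; apply: ge_sup => [|_ [s _ <-] //]; exists `|x t0|, t0.
Qed.

Lemma sup_norm_ge0 x : X x -> 0 <= sup_norm x.
Proof. by move=> Xx; exact: le_trans (normr_ge0 _) (ler_sup_norm t0 Xx). Qed.

Lemma sup_norm_eq0 x : X x -> sup_norm x <= 0 -> x = 0.
Proof.
move=> Xx n0; apply/funext => t; apply/normr0_eq0/le_anti.
by rewrite normr_ge0 andbT (le_trans (ler_sup_norm t Xx)).
Qed.

Lemma sup_normD x y : X x -> X y -> sup_norm (x + y) <= sup_norm x + sup_norm y.
Proof.
move=> Xx Xy; apply: sup_norm_ler => t.
by rewrite (le_trans (ler_normD _ _)) // lerD // ler_sup_norm.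
Qed.

Lemma sup_normZ (a : R) x : X x -> sup_norm (a *: x) = `|a| * sup_norm x.
Proof.
move=> Xx; apply/le_anti/andP; split.
  by apply: sup_norm_ler => t; rewrite normrM ler_wpM2l // ler_sup_norm.
have [->|a0] := eqVneq a 0.
  by rewrite normr0 mul0r; apply/sup_norm_ge0/sublatticeZ.
rewrite -ler_pdivlMl ?normr_gt0 //; apply: sup_norm_ler => t.
rewrite ler_pdivlMl ?normr_gt0 // -normrM.
exact/(@ler_sup_norm (a *: x))/sublatticeZ.
Qed.

Lemma sup_norm_mono x y : X y -> fun_le (fun_abs x) (fun_abs y) ->
  sup_norm x <= sup_norm y.
Proof.
move=> Xy xy; apply: sup_norm_ler => t.
exact: le_trans (xy t) (ler_sup_norm t Xy).
Qed.

Lemma fun_le_abs x y : fun_le 0 x -> fun_le x y -> fun_le (fun_abs x) (fun_abs y).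
Proof.
move=> x0 xy; rewrite !fun_abs_id //.
exact: fun_le_trans x0 xy.
Qed.

End SupNorm.

(** * Norming families of lattice homomorphisms *)

Definition active {R : realType} {K : Type} (X : set (K -> R))
  (h : (K -> R) -> R) : Prop := exists2 x, X x & h x <> 0.

(* The indices [i] with [f i = 0] on [X] are padding: they let [nat] index a
   family that may be finite. *)
Record norming_homs {R : realType} {K : Type} (X : set (K -> R))
    (f : nat -> (K -> R) -> R) : Prop := NormingHoms {
  nh_hom : forall i, lattice_hom X (f i) ;
  nh_le : forall i x, X x -> `|f i x| <= sup_norm x ;
  nh_norm : forall x M, X x -> 0 <= M -> (forall i, `|f i x| <= M) ->
    sup_norm x <= M ;
  nh_peak : forall i, active X (f i) ->
    exists p, [/\ X p, fun_le 0 p, f i p = 1 & sup_norm p <= 1] ;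
  nh_sep : forall i j, i <> j -> active X (f i) ->
    exists z, [/\ X z, fun_le 0 z, f j z = 0 & 0 < f i z] }.

Section NormingHoms.
Context {R : realType} {K : Type} {X : set (K -> R)} (hX : vector_sublattice X).
Context (t0 : K) (bX : forall x, X x -> exists M : R, forall t, `|x t| <= M).
Context {f : nat -> (K -> R) -> R} (nf : norming_homs X f).
Implicit Types (x y z : K -> R) (h : (K -> R) -> R).

Let hf := nh_hom nf.

Lemma inactive0 i x : ~ active X (f i) -> X x -> f i x = 0.
Proof. by move=> ai Xx; apply: contrapT => fx; apply: ai; exists x. Qed.

Lemma eq_norming x y : X x -> X y -> (forall i, active X (f i) -> f i x = f i y) ->
  x = y.
Proof.
move=> Xx Xy fxy; apply/eqP; rewrite -subr_eq0; apply/eqP.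
have XB := sublatticeB hX Xx Xy.
apply: (sup_norm_eq0 bX) => //; apply: (nh_norm nf) => // i.
rewrite (homB hX (hf i)) //; have [ai|ai] := pselect (active X (f i)).
  by rewrite fxy // subrr normr0.
by rewrite !inactive0 // subrr normr0.
Qed.

Lemma hom_scale (b : R) h : 0 <= b -> lattice_hom X h ->
  lattice_hom X (fun x => b * h x).
Proof.
move=> b0 hh; split=> [a x y Xx Xy|x y Xx Xy|x y Xx Xy].
- by rewrite (homZD hh) //; ring.
- by rewrite (hom_max hh) // maxr_pMr.
- by rewrite (hom_min hh) // minr_pMr.
Qed.

(** * The weighted sup norm *)

Section WeightedSup.
Context (w : nat -> R) (W : R) (w1 : forall i, 1 <= w i) (wW : forall i, w i <= W).

Definition weighted_sup x : R := sup [set w i * `|f i x| | i in [set: nat]].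
Local Notation N := weighted_sup.

Let w0 i : 0 < w i. Proof. exact: lt_le_trans (w1 i). Qed.

Lemma ler_weighted_sup i x : X x -> w i * `|f i x| <= N x.
Proof.
move=> Xx; apply: ub_le_sup; last by exists i.
exists (W * sup_norm x) => _ [j _ <-].
by apply: ler_pM => //; [exact: ltW (w0 _)|exact: (nh_le nf)].
Qed.

Lemma weighted_sup_ler x M : (forall i, w i * `|f i x| <= M) -> N x <= M.
Proof.
by move=> xM; apply: ge_sup => [|_ [s _ <-] //]; exists (w 0%N * `|f 0%N x|), 0%N.
Qed.

Lemma weighted_sup_ge0 x : X x -> 0 <= N x.
Proof.
move=> Xx; apply: le_trans (ler_weighted_sup 0%N Xx).
by rewrite mulr_ge0 // ltW.
Qed.

Lemma weighted_sup_equiv x : X x -> sup_norm x <= N x /\ N x <= W * sup_norm x.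
Proof.
move=> Xx; split.
  apply: (nh_norm nf) => // [|i]; first exact: weighted_sup_ge0.
  by rewrite (le_trans _ (ler_weighted_sup i Xx)) // ler_peMl.
apply: weighted_sup_ler => i.
by apply: ler_pM => //; [exact: ltW (w0 _)|exact: (nh_le nf)].
Qed.

Lemma weighted_sup_AM : is_AM_norm X N.
Proof.
have mono x y : X x -> X y -> fun_le (fun_abs x) (fun_abs y) -> N x <= N y.
  move=> Xx Xy xy; apply: weighted_sup_ler => i.
  rewrite (le_trans _ (ler_weighted_sup i Xy)) // ler_wpM2l ?(ltW (w0 i)) //.
  rewrite -!(hom_abs hX (hf i)) //.
  by apply: (hom_le (hf i)) => //; exact: sublattice_abs.
split; first split => //.
  split=> [x y Xx Xy|a x Xx|x Xx Nx0].
  - apply: weighted_sup_ler => i.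
    have := ler_weighted_sup i Xx; have := ler_weighted_sup i Xy.
    rewrite (homD (hf i)) // => Ny Nx; apply: le_trans (lerD Nx Ny).
    by rewrite -mulrDr ler_wpM2l ?ler_normD // ltW.
  (* The reverse inequality is this one applied to [a^-1] and [a *: x]. *)
  - have NZ b y : X y -> N (b *: y) <= `|b| * N y.
      move=> Xy; apply: weighted_sup_ler => i.
      by rewrite (homZ hX (hf i)) // normrM mulrCA ler_wpM2l // ler_weighted_sup.
    apply/le_anti/andP; split; first exact: NZ.
    have [->|a0] := eqVneq a 0.
      by rewrite normr0 mul0r; apply: weighted_sup_ge0; exact: sublatticeZ.
    rewrite -ler_pdivlMl ?normr_gt0 //.
    have := NZ a^-1 (a *: x) (sublatticeZ hX a Xx).
    by rewrite scalerA mulVf // scale1r normfV.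
  - apply: (sup_norm_eq0 bX) => //; rewrite -Nx0.
    by case: (weighted_sup_equiv Xx).
move=> x y Xx Xy x0 y0; have Xm := sublattice_max hX Xx Xy.
have le_max_l : fun_le x (x \max y) by move=> t; rewrite /= le_max lexx.
have le_max_r : fun_le y (x \max y) by move=> t; rewrite /= le_max lexx orbT.
have fge0 i z : X z -> fun_le 0 z -> `|f i z| = f i z.
  by move=> Xz z0; rewrite ger0_norm // (hom_ge0 hX (hf i)).
apply/le_anti/andP; split; last first.
  by rewrite ge_max; apply/andP; split; apply: mono => //; exact: fun_le_abs.
apply: weighted_sup_ler => i.
have -> : `|f i (x \max y)| = Num.max `|f i x| `|f i y|.
  rewrite fge0 // ?(hom_max (hf i)) ?fge0 // => t.
  exact: le_trans (x0 t) (le_max_l t).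
rewrite maxr_pMr ?(ltW (w0 i)) // ge_max !le_max.
by rewrite !ler_weighted_sup // orbT.
Qed.

(* The infimum of the admissible [r] is the ratio [a_i / w_i] of the header when
   [h = w_i f_i]. *)
Definition punctured_bound h (r : R) : Prop :=
  exists x, [/\ X x, fun_le 0 x, h x = 1
    & forall z, X z -> fun_le 0 z -> fun_le z x -> h z = 0 -> N z <= r].

(** If some positive [z] in the kernel of [h] is seen by [f j], cutting [x] by [z] yields an element
    below [x] that [h] kills and on which [f j] is unchanged; its norm is at most [r]. *)
Lemma punctured_le h r x j : lattice_hom X h -> X x -> fun_le 0 x ->
  (forall z, X z -> fun_le 0 z -> fun_le z x -> h z = 0 -> N z <= r) ->
  (active X (f j) -> exists z, [/\ X z, fun_le 0 z, h z = 0 & 0 < f j z]) ->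
  w j * f j x <= r.
Proof.
move=> hh Xx x0 xr sep; have r0 : 0 <= r.
  apply: le_trans (xr 0 _ _ _ _); rewrite ?(hom0 hX hh) //.
  - by apply: weighted_sup_ge0; exact: sublattice0.
  - exact: sublattice0.
have [aj|aj] := pselect (active X (f j)); last by rewrite inactive0 // mulr0.
have [z [Xz z0 hz fz]] := sep aj.
have [y [Xy y0 yx fy hy]] := hom_cut hX hh (hf j) Xx x0 Xz z0 hz fz.
rewrite -fy (le_trans _ (xr y Xy y0 yx hy)) // (le_trans _ (ler_weighted_sup j Xy)) //.
by rewrite ler_wpM2l ?(ltW (w0 j)) // ler_norm.
Qed.

(** Since [r < 1 <= N x], some term [w k * f k x] exceeds [r]. By [punctured_le], [f k] then
    vanishes on the kernel of [h], so [f k] is [f k x] times [h]. The constant [w k * f k x] is at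
    most 1 because of [y], and not less than 1, since all other terms of [N x] are at most [r]. *)
Lemma punctured_identify h r : lattice_hom X h -> (forall x, X x -> h x <= N x) ->
  (exists y, [/\ X y, h y = 1 & N y <= 1]) -> punctured_bound h r -> r < 1 ->
  exists2 k, active X (f k) & forall x, X x -> h x = w k * f k x.
Proof.
move=> hh hN [y [Xy hy Ny]] [x [Xx x0 hx xr]] r1.
have Nx : 1 <= N x by rewrite -hx hN.
have fx0 j : 0 <= f j x by exact: (hom_ge0 hX (hf j)).
have r0 : 0 <= r.
  apply: le_trans (xr 0 _ _ _ _); rewrite ?(hom0 hX hh) //.
  - by apply: weighted_sup_ge0; exact: sublattice0.
  - exact: sublattice0.
have [k rk] : exists k, r < w k * f k x.
  apply: contrapT => nk; suff : N x <= r by move=> ?; lra.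
  apply: weighted_sup_ler => j; rewrite ger0_norm // leNgt.
  by apply/negP => jr; apply: nk; exists j.
have ak : active X (f k).
  by exists x => // fk; move: rk; rewrite fk mulr0 => ?; lra.
have prop z : X z -> f k z = f k x * h z.
  apply: (hom_proportional hX hh (hf k) Xx hx) => {}z Xz z0 hz.
  apply: contrapT => /eqP fz; move: rk; apply/negP; rewrite -leNgt.
  apply: (punctured_le hh Xx x0 xr) => _; exists z; split => //.
  by rewrite lt_neqAle eq_sym fz (hom_ge0 hX (hf k)).
have kx0 : f k x != 0 by apply/eqP => fk; move: rk; rewrite fk mulr0 => ?; lra.
suff wk : w k * f k x = 1.
  by exists k => // z Xz; rewrite prop // mulrA wk mul1r.
apply/le_anti/andP; split.
  have := ler_weighted_sup k Xy; rewrite prop // hy mulr1 ger0_norm //.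
  by move=> /le_trans -> //.
rewrite leNgt; apply/negP => wk1.
suff : N x <= Num.max r (w k * f k x).
  by rewrite le_max => /orP[]; lra.
apply: weighted_sup_ler => j; rewrite ger0_norm // le_max.
have [->|/eqP jk] := eqVneq j k; first by rewrite lexx orbT.
rewrite (punctured_le hh Xx x0 xr) // => /(nh_sep nf jk)[z [Xz z0 fz fjz]].
exists z; split => //; move: fz; rewrite prop // => /eqP.
by rewrite mulf_eq0 (negbTE kx0) => /eqP.
Qed.

Lemma punctured_iso T h r : lattice_isometry X N T -> lattice_hom X h ->
  punctured_bound (h \o T) r <-> punctured_bound h r.
Proof.
move=> isoT hh; have nN : is_norm X N by case: weighted_sup_AM => -[].
split=> [[x [Xx x0 hx xr]]|[y [Xy y0 hy yr]]].
  exists (T x); split => //; first exact: (iso_in isoT).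
    by apply/(iso_ge0 hX nN isoT Xx).
  move=> _ /(iso_onto isoT)[z Xz <-] /(iso_ge0 hX nN isoT Xz) z0.
  move=> /(iso_le hX nN isoT Xz Xx) zx hz.
  by rewrite (iso_norm isoT) //; apply: xr.
have [x Xx xy] := iso_onto isoT Xy; subst y.
exists x; split => //; first by apply/(iso_ge0 hX nN isoT Xx).
move=> z Xz /(iso_ge0 hX nN isoT Xz) z0 /(iso_le hX nN isoT Xz Xx) zx hz.
by rewrite -(iso_norm isoT) //; apply: yr => //; exact: (iso_in isoT).
Qed.

End WeightedSup.
End NormingHoms.
Arguments weighted_sup {R K} f w x.
Arguments punctured_bound {R K} X f w h r.

(** * Generic choice of the weights *)

Lemma not_countable_itv_oo (R : realType) (a b : R) : a < b ->
  ~ countable [set` `]a, b[].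
Proof.
move=> ab /countable_lebesgue_measure0; rewrite lebesgue_measure_itv /=.
rewrite lte_fin ab => -[] /eqP.
by rewrite subr_eq0 gt_eqF.
Qed.

(* The parameter [th] is chosen outside a countable set of values making two
   ratios coincide. *)
Definition geo_weight {R : realType} (th : R) (i : nat) : R := 1 + th * 2^-1 ^+ i.

Lemma exists_generic_scale (R : realType) (a : nat -> R) (s : R) : 0 < s ->
  exists2 th, 0 < th < s & forall i k, i <> k -> a i != 0 ->
    a i / geo_weight th i <> a k / geo_weight th k.
Proof.
move=> s0; pose q (i : nat) : R := 2^-1 ^+ i.
(* The solution [th] of [a i * (1 + th * q k) = a k * (1 + th * q i)], for [ik = (i, k)]. *)
pose bad (ik : nat * nat) := (a ik.2 - a ik.1) / (a ik.1 * q ik.2 - a ik.2 * q ik.1).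
have [th /andP[th0 ths] good] : exists2 th, 0 < th < s & ~ range bad th.
  apply: contrapT => nth; apply: (not_countable_itv_oo s0).
  apply: (@sub_countable _ _ _ (range bad)); last first.
    by apply: sub_countable (card_image_le _ _) _.
  apply: subset_card_le => th; rewrite /= in_itv /= => ths.
  by apply: contrapT => good; apply: nth; exists th.
exists th => [|i k ik ai0 aik]; first by rewrite th0.
have q0 j : 0 < q j by rewrite exprn_gt0.
have wp j : 1 + th * q j != 0.
  by rewrite gt_eqF // ltr_wpDr // mulr_ge0 // ltW.
move: aik; rewrite /geo_weight -/(q i) -/(q k) => /eqP.
rewrite eqr_div // => /eqP E.
have E' : th * (a i * q k - a k * q i) = a k - a i by lra.
(* If the coefficient of [th] vanishes, then [a k = a i], and [a i != 0] forces [q k = q i], that is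
   [i = k]. *)
have [D|D] := eqVneq (a i * q k - a k * q i) 0.
  have aE : a k = a i by move: E'; rewrite D mulr0 => ?; lra.
  move/eqP: D; rewrite aE -mulrBr mulf_eq0 (negbTE ai0) subr_eq0 /= => /eqP.
  move/(ieexprIn _ _) => ki; apply: ik; apply/esym/ki => //.
  by rewrite invr_eq1 pnatr_eq1.
by apply: good; exists (i, k) => //; rewrite /bad /= -E' mulfK.
Qed.

(** * Isolation of a functional, and rigidity of the weighted sup norm *)

Section Isolation.
Context {R : realType} {K : Type} {X : set (K -> R)} (hX : vector_sublattice X).
Context (t0 : K) (bX : forall x, X x -> exists M : R, forall t, `|x t| <= M).
Context {f : nat -> (K -> R) -> R} (nf : norming_homs X f).
Implicit Types (x y z : K -> R) (h : (K -> R) -> R).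

Let hf := nh_hom nf.

Definition isolating i (r : R) x : Prop :=
  [/\ X x, fun_le 0 x, f i x = 1 & forall j, j <> i -> f j x <= r].

(** This is the quantity [a_i] of the header: how small all the other functionals can be kept on a
    positive element with [f i x = 1]. *)
Definition isolation i : R := inf [set r | 0 <= r /\ exists x, isolating i r x].

Lemma isolation_le i r x : 0 <= r -> isolating i r x -> isolation i <= r.
Proof.
move=> r0 rx; apply: ge_inf; first by exists 0 => s [].
by split => //; exists x.
Qed.

Lemma isolation_has i : active X (f i) ->
  has_inf [set r | 0 <= r /\ exists x, isolating i r x].
Proof.
move=> /(nh_peak nf)[p [Xp p0 fp np]]; split; last by exists 0 => s [].
exists 1; split => //; exists p; split => // j _.
by apply: le_trans (ler_norm _) (le_trans (nh_le nf j Xp) np).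
Qed.

Lemma isolation_ge0 i : active X (f i) -> 0 <= isolation i.
Proof. by move=> /isolation_has[ne _]; apply: lb_le_inf => // s []. Qed.

Lemma isolation_le1 i : active X (f i) -> isolation i <= 1.
Proof.
move=> /(nh_peak nf)[p [Xp p0 fp np]]; apply: (@isolation_le _ _ p) => //.
split => // j _.
by apply: le_trans (ler_norm _) (le_trans (nh_le nf j Xp) np).
Qed.

Lemma isolation_lt i r : active X (f i) -> isolation i < r ->
  exists x, isolating i r x.
Proof.
move=> /isolation_has ai; rewrite -subr_gt0 => /inf_adherent /(_ ai)[s [s0 [x sx]]].
rewrite addrC subrK => sr; exists x; case: sx => Xx x0 fx xs; split => // j ji.
by rewrite (le_trans (xs j ji)) // ltW.
Qed.

Section GenericWeights.
Context (th : R) (th0 : 0 < th).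

Local Notation w := (geo_weight th).
Local Notation N := (weighted_sup f w).
Context (generic : forall i k, active X (f i) -> active X (f k) -> i <> k ->
  isolation i / w i <> isolation k / w k).

Lemma geo_weight_gt1 i : 1 < w i.
Proof. by rewrite ltrDl mulr_gt0 // exprn_gt0. Qed.

Lemma geo_weight_anti m n : (m <= n)%N -> w n <= w m.
Proof. by move=> mn; rewrite lerD2l ler_wpM2l ?exp_half_anti // ltW. Qed.

Lemma geo_weight_le i : w i <= 1 + th.
Proof. by rewrite (le_trans (geo_weight_anti (leq0n i))) // /geo_weight expr0 mulr1. Qed.

Let w1 i : 1 <= w i. Proof. exact/ltW/geo_weight_gt1. Qed.
Let w0 i : 0 < w i. Proof. exact: lt_le_trans (w1 i). Qed.

Let scaled i x := w i * f i x.
Let hscaled i : lattice_hom X (scaled i).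
Proof. by apply: hom_scale => //; exact: ltW. Qed.

Lemma punctured_scaled_le i r x : active X (f i) -> X x -> fun_le 0 x ->
  (forall z, X z -> fun_le 0 z -> fun_le z x -> scaled i z = 0 -> N z <= r) ->
  forall j, j <> i -> w j * f j x <= r.
Proof.
move=> ai Xx x0 xr j ji.
apply: (punctured_le hX nf w1 geo_weight_le (hscaled i) Xx x0 xr).
move=> /(nh_sep nf ji)[z [Xz z0 fz fjz]]; exists z; split => //.
by rewrite /scaled fz mulr0.
Qed.

(** Rescaling the witness by [w i] normalizes [f i] to 1; as all weights are at least 1, the bounds
    on [w j * f j x] also bound [f j x], so [w i * r] is admissible for [isolation i]. *)
Lemma punctured_isolation i r : active X (f i) -> punctured_bound X f w (scaled i) r ->
  isolation i / w i <= r.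
Proof.
move=> ai [x [Xx x0 hx xr]]; have xj := punctured_scaled_le ai Xx x0 xr.
have r0 : 0 <= r.
  (* Any index other than [i] would do to see that [r] is nonnegative. *)
  have := xj i.+1 (@PeanoNat.Nat.neq_succ_diag_l i).
  by apply: le_trans; rewrite mulr_ge0 ?(hom_ge0 hX (hf _)) // ltW.
rewrite ler_pdivrMr // mulrC.
apply: (@isolation_le _ _ (w i *: x)); first by rewrite mulr_ge0 // ltW.
split; [exact: sublatticeZ|exact/fun_le0Z/x0/ltW|by rewrite (homZ hX (hf i))|].
move=> j ji; rewrite (homZ hX (hf j)) // ler_wpM2l ?(ltW (w0 i)) //.
apply: le_trans (xj j ji); rewrite ler_peMl //.
exact: (hom_ge0 hX (hf j)).
Qed.

(** Cut away the first [n] functionals except [f i] from a nearly optimal isolating element. The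
    remaining weights are at most [w n], close enough to 1 not to spoil the bound. *)
Lemma isolation_punctured i r : active X (f i) -> isolation i / w i < r ->
  punctured_bound X f w (scaled i) r.
Proof.
move=> ai; rewrite ltr_pdivrMr // => air.
have a0 := isolation_ge0 ai.
have wi := geo_weight_gt1 i; have r0 : 0 < r.
  by rewrite -(pmulr_lgt0 _ (w0 i)) (le_lt_trans a0).
(* The midpoint leaves room on both sides: [isolation i < s] provides the isolating element, and
   [s < r * w i] absorbs the factor [w n]. *)
pose s := (isolation i + r * w i) / 2.
have rw0 : 0 < r * w i by rewrite mulr_gt0.
have s0 : 0 < s by rewrite /s; lra.
have [x0 [Xx x00 fx0 fxs]] : exists x, isolating i s x.
  by apply: isolation_lt => //; rewrite /s; lra.
(* This is [w n * s < r * w i] solved for the power of one half in [w n]. *)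
have [n nlt] : exists n, (2^-1 : R) ^+ n < (r * w i - s) / (th * s).
  by apply: exp_half_lt; rewrite divr_gt0 // ?(mulr_gt0 th0 s0) // /s; lra.
have wns : w n * s <= r * w i.
  by move: nlt; rewrite ltr_pdivlMr ?(mulr_gt0 th0 s0) // /geo_weight => ?; lra.
have [y [Xy y0 yx fy fjy]] : exists y, [/\ X y, fun_le 0 y, fun_le y x0,
    f i y = f i x0 & forall k, (k < n)%N -> k <> i -> f k y = 0].
  apply: (hom_cut_finite hX n hf (hf i) Xx x00) => k ki.
  by have [z [Xz z0 fz fiz]] := nh_sep nf (nesym ki) ai; exists z.
have Xwy := sublatticeZ hX (w i)^-1 Xy.
have wi0 : 0 <= (w i)^-1 by rewrite invr_ge0 ltW.
exists ((w i)^-1 *: y); split => //; first exact: fun_le0Z.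
  by rewrite /scaled (homZ hX (hf i)) // fy fx0 mulr1 divff // gt_eqF.
move=> z Xz z0 zy /eqP; rewrite mulf_eq0 gt_eqF //= => /eqP fz.
apply: weighted_sup_ler => j; rewrite ger0_norm ?(hom_ge0 hX (hf j)) //.
have [->|/eqP ji] := eqVneq j i; first by rewrite fz mulr0 ltW.
have fzj : f j z <= (w i)^-1 * f j y.
  by rewrite -(homZ hX (hf j)) //; apply: (hom_le (hf j)).
have [jn|nj] := ltnP j n.
  apply: (@le_trans _ _ 0); last exact: ltW.
  by move: fzj; rewrite fjy // mulr0 (pmulr_rle0 _ (w0 j)).
have fjs : f j y <= s.
  by apply: le_trans (fxs j ji); apply: (hom_le (hf j)).
apply: (@le_trans _ _ (w n * ((w i)^-1 * s))).
  apply: ler_pM; [exact: ltW|exact: (hom_ge0 hX (hf j))|exact: geo_weight_anti|].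
  by apply: le_trans fzj _; rewrite ler_wpM2l.
by rewrite mulrCA mulrC ler_pdivrMr.
Qed.

Theorem weighted_sup_rigid : only_trivial_lattice_isometry X N.
Proof.
move=> T isoT x Xx.
have nN : is_norm X N.
  by case: (weighted_sup_AM hX bX nf w1 geo_weight_le) => -[].
apply: (eq_norming hX bX nf) => // [|i ai]; first exact: (iso_in isoT).
have hiT := hom_iso isoT (hscaled i).
have ratio_lt1 : isolation i / w i < 1.
  rewrite ltr_pdivrMr // mul1r.
  exact: le_lt_trans (isolation_le1 ai) (geo_weight_gt1 i).
pose r := (isolation i / w i + 1) / 2.
have r1 : r < 1 by rewrite /r; lra.
have Pi : punctured_bound X f w (scaled i) r.
  by apply: isolation_punctured => //; rewrite /r; lra.
have Piso q := punctured_iso hX bX nf w1 geo_weight_le q isoT (hscaled i).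
have [k ak hk] : exists2 k, active X (f k) &
    forall x, X x -> (scaled i \o T) x = w k * f k x.
  apply: (punctured_identify hX nf w1 geo_weight_le hiT _ _ _ r1).
  - move=> y Xy /=; rewrite -(iso_norm isoT Xy).
    have XTy := iso_in isoT Xy.
    apply: le_trans (ler_weighted_sup nf w1 geo_weight_le i XTy).
    by rewrite ler_wpM2l ?ler_norm // ltW.
  (* The witness [u] of [Pi] has norm at most 1: its [i]-th term is 1 and the others are at most
     [r]. Its preimage under [T] is the norming element required. *)
  - have [u [Xu u0 hu ur]] := Pi.
    have [v Xv vu] := iso_onto isoT Xu; exists v; split => //.
      by rewrite /= vu.
    rewrite -(iso_norm isoT Xv) vu; apply: weighted_sup_ler => j.
    rewrite ger0_norm ?(hom_ge0 hX (hf j)) //.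
    have [->|/eqP ji] := eqVneq j i; first by rewrite -hu.
    by apply: le_trans (punctured_scaled_le ai Xu u0 ur ji) _; exact: ltW.
  - exact/Piso.
have Pk q : punctured_bound X f w (scaled k) q <-> punctured_bound X f w (scaled i) q.
  rewrite -Piso; split=> -[u [Xu u0 hu uq]]; exists u; split => //.
  - by rewrite hk.
  - by move=> z Xz z0 zu hz; apply: uq => //; rewrite -hz hk.
  - by rewrite -hu hk.
  - by move=> z Xz z0 zu hz; apply: uq => //; rewrite hk.
have ik : i = k.
  apply: contrapT => ik; apply: (generic ai ak ik).
  (* Both ratios are the infimum of the same set of punctured bounds, by [Pk]. *)
  apply/le_anti/andP; split; apply/ler_addgt0Pr => e e0.
    by apply: punctured_isolation => //; apply/Pk/isolation_punctured => //; rewrite ltrDl.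
  by apply: punctured_isolation => //; apply/Pk/isolation_punctured => //; rewrite ltrDl.
have := hk x Xx; rewrite /= /scaled -ik => /mulfI; apply.
by rewrite gt_eqF.
Qed.

End GenericWeights.
End Isolation.
Arguments isolating {R K} X f i r x.
Arguments isolation {R K} X f i.

(** * The sup norm plus a discrete mass *)

Section SumNorm.
Context {R : realType} {K : Type} {X : set (K -> R)} (hX : vector_sublattice X).
Context (t0 : K) (bX : forall x, X x -> exists M : R, forall t, `|x t| <= M).
Context {f : nat -> (K -> R) -> R} (nf : norming_homs X f).
Context (s : R) (s0 : 0 < s).
Implicit Types (x y z u : K -> R) (g h : (K -> R) -> R).

Let hf := nh_hom nf.

(** The exponent [i.+1] makes the masses of all indices sum to [s]. *)
Definition mass i : R := s * 2^-1 ^+ i.+1.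

Lemma mass_gt0 i : 0 < mass i.
Proof. by rewrite mulr_gt0 // exprn_gt0. Qed.

Lemma mass_inj i k : mass i = mass k -> i = k.
Proof.
move=> /mulfI => /(_ (lt0r_neq0 s0)) /(ieexprIn _ _) ik.
by apply/succn_inj/ik => //; rewrite invr_eq1 pnatr_eq1.
Qed.

Definition partial_mass n x : R := \sum_(i < n) mass i * `|f i x|.
Definition total_mass x : R := sup [set partial_mass n x | n in [set: nat]].
Definition sum_norm x : R := sup_norm x + total_mass x.
Local Notation S := partial_mass.
Local Notation F := total_mass.
Local Notation N := sum_norm.

Lemma partial_massS n x : S n.+1 x = S n x + mass n * `|f n x|.
Proof. by rewrite /S big_ord_recr. Qed.

Lemma partial_mass_term n x : 0 <= mass n * `|f n x|.
Proof. by rewrite mulr_ge0 // ltW // mass_gt0. Qed.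

Lemma partial_mass_nd m n x : (m <= n)%N -> S m x <= S n x.
Proof.
elim: n => [|n IHn]; first by rewrite leqn0 => /eqP ->.
rewrite leq_eqVlt => /orP[/eqP -> //|]; rewrite ltnS => /IHn mn.
by rewrite partial_massS (le_trans mn) // lerDl partial_mass_term.
Qed.

Lemma partial_mass_tail m n x : X x ->
  S m x <= S n x + s * 2^-1 ^+ n * sup_norm x.
Proof.
move=> Xx; have x0 := sup_norm_ge0 t0 bX Xx.
(* The exact sum of the masses from [n] to [n + k - 1] is kept so that the induction closes; its
   negative term is dropped afterwards. *)
have tail k : S (n + k) x <= S n x + s * (2^-1 ^+ n - 2^-1 ^+ (n + k)) * sup_norm x.
  elim: k => [|k IHk]; first by rewrite addn0 subrr mulr0 mul0r addr0.
  rewrite addnS partial_massS.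
  have : mass (n + k) * `|f (n + k)%N x| <= mass (n + k) * sup_norm x.
    by rewrite ler_wpM2l ?(nh_le nf) // ltW // mass_gt0.
  rewrite {2}/mass exprS => ?; lra.
apply: le_trans (partial_mass_nd x (leq_addl n m)) _.
apply: le_trans (tail m) _; rewrite lerD2l ler_wpM2r // ler_wpM2l ?(ltW s0) //.
by rewrite gerBl exp_half_ge0.
Qed.

Lemma partial_mass_ub n x : X x -> S n x <= s * sup_norm x.
Proof.
move=> Xx; apply: le_trans (partial_mass_tail n 0 Xx) _.
by rewrite /S big_ord0 add0r expr0 mulr1.
Qed.

Lemma ler_total_mass n x : X x -> S n x <= F x.
Proof.
move=> Xx; apply: ub_le_sup; last by exists n.
by exists (s * sup_norm x) => _ [m _ <-]; exact: partial_mass_ub.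
Qed.

Lemma total_mass_ler x M : (forall n, S n x <= M) -> F x <= M.
Proof. by move=> xM; apply: ge_sup => [|_ [n _ <-] //]; exists (S 0 x), 0%N. Qed.

Lemma total_mass_ge0 x : X x -> 0 <= F x.
Proof. by move=> Xx; have := ler_total_mass 0 Xx; rewrite /S big_ord0. Qed.

Lemma total_mass_tail n x : X x -> F x <= S n x + s * 2^-1 ^+ n * sup_norm x.
Proof. by move=> Xx; apply: total_mass_ler => m; exact: partial_mass_tail. Qed.

Lemma mass_le_total i x : X x -> mass i * `|f i x| <= F x.
Proof.
move=> Xx; apply: le_trans (ler_total_mass i.+1 Xx).
by rewrite partial_massS lerDr sumr_ge0 // => j _; exact: partial_mass_term.
Qed.

Lemma total_mass_mono x y : X x -> X y -> fun_le (fun_abs x) (fun_abs y) -> F x <= F y.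
Proof.
move=> Xx Xy xy; apply: total_mass_ler => n.
apply: le_trans (ler_total_mass n Xy); apply: ler_sum => i _.
rewrite ler_wpM2l ?(ltW (mass_gt0 i)) // -!(hom_abs hX (hf i)) //.
by apply: (hom_le (hf i)) => //; exact: sublattice_abs.
Qed.

Lemma total_massD x y : X x -> X y -> F (x + y) <= F x + F y.
Proof.
move=> Xx Xy; apply: total_mass_ler => n.
apply: le_trans (lerD (ler_total_mass n Xx) (ler_total_mass n Xy)).
rewrite /S -big_split; apply: ler_sum => i _ /=.
by rewrite (homD (hf i)) // -mulrDr ler_wpM2l ?ler_normD // ltW // mass_gt0.
Qed.

(** Partial sums of [x] and of [y], of independent lengths [m] and [n], are both dominated by those
    of length [m + n], where positivity makes the terms add up exactly. *)
Lemma total_massD_ge0 x y : X x -> X y -> fun_le 0 x -> fun_le 0 y ->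
  F (x + y) = F x + F y.
Proof.
move=> Xx Xy x0 y0; apply/le_anti; rewrite total_massD //= -lerBrDr.
apply: total_mass_ler => m; rewrite lerBrDr addrC -lerBrDr.
apply: total_mass_ler => n; rewrite lerBrDr.
have XD := sublatticeD hX Xx Xy.
apply: le_trans (ler_total_mass (m + n) XD).
apply: le_trans (lerD (partial_mass_nd y (leq_addl m n)) (partial_mass_nd x (leq_addr n m))) _.
rewrite /S -big_split; apply: ler_sum => i _ /=.
have fx := hom_ge0 hX (hf i) Xx x0; have fy := hom_ge0 hX (hf i) Xy y0.
by rewrite (homD (hf i)) // !ger0_norm ?addr_ge0 // -mulrDr addrC.
Qed.

Lemma sum_norm_mono x y : X x -> X y -> fun_le (fun_abs x) (fun_abs y) -> N x <= N y.
Proof.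
by move=> Xx Xy xy; rewrite lerD ?total_mass_mono // (sup_norm_mono t0 bX).
Qed.

Lemma sum_norm_equiv x : X x -> sup_norm x <= N x /\ N x <= (1 + s) * sup_norm x.
Proof.
move=> Xx; rewrite lerDl total_mass_ge0 // mulrDl mul1r lerD2l; split => //.
by apply: total_mass_ler => n; exact: partial_mass_ub.
Qed.

Lemma sum_norm_ge0 x : X x -> 0 <= N x.
Proof.
by move=> Xx; rewrite addr_ge0 ?total_mass_ge0 // (sup_norm_ge0 t0 bX).
Qed.

Lemma total_massZ (a : R) x : X x -> F (a *: x) = `|a| * F x.
Proof.
have FZ b y : X y -> F (b *: y) <= `|b| * F y.
  move=> Xy; apply: total_mass_ler => n.
  have -> : S n (b *: y) = `|b| * S n y.
    rewrite /S mulr_sumr; apply: eq_bigr => i _.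
    by rewrite (homZ hX (hf i)) // normrM mulrCA.
  by rewrite ler_wpM2l // ler_total_mass.
move=> Xx; apply/le_anti; rewrite FZ //=.
have [->|a0] := eqVneq a 0.
  by rewrite normr0 mul0r; apply: total_mass_ge0; exact: sublatticeZ.
rewrite -ler_pdivlMl ?normr_gt0 //.
have := FZ a^-1 (a *: x) (sublatticeZ hX a Xx).
by rewrite scalerA mulVf // scale1r normfV.
Qed.

Lemma sum_normZ (a : R) x : X x -> N (a *: x) = `|a| * N x.
Proof.
by move=> Xx; rewrite /N (sup_normZ hX t0 bX) // total_massZ // mulrDr.
Qed.

Lemma sum_norm_lattice : is_lattice_norm X N.
Proof.
split; last by move=> x y Xx Xy; exact: sum_norm_mono.
split=> [x y Xx Xy|a x Xx|x Xx Nx0].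
- have := total_massD Xx Xy; have := sup_normD t0 bX Xx Xy; rewrite /N; lra.
- exact: sum_normZ.
- by apply: (sup_norm_eq0 bX) => //; rewrite -Nx0; case: (sum_norm_equiv Xx).
Qed.

Lemma fun_ge0_at x t : fun_le 0 x -> 0 <= x t.
Proof. exact. Qed.

Lemma disjoint_at x u t : u \min x = 0 -> Num.min (u t) (x t) = 0.
Proof. by move=> /(congr1 (@^~ t)). Qed.

(** At every point at most one of [u] and [x] is nonzero. *)
Lemma sup_norm_disjoint x u : X x -> X u -> fun_le 0 x -> fun_le 0 u ->
  u \min x = 0 -> sup_norm x <= sup_norm u -> sup_norm (u + x) = sup_norm u.
Proof.
move=> Xx Xu x0 u0 ux xu; apply/le_anti/andP; split.
  apply: (sup_norm_ler t0) => t; have uxt := disjoint_at t ux.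
  have := ler_sup_norm bX t Xx; have := ler_sup_norm bX t Xu.
  have -> : (u + x) t = u t + x t by [].
  have xt := fun_ge0_at t x0; have ut := fun_ge0_at t u0.
  rewrite !ger0_norm ?addr_ge0 //.
  move: uxt; rewrite /Order.min; case: ifP => _ ->; lra.
apply: (sup_norm_mono t0 bX); first exact: sublatticeD.
apply: fun_le_abs => // t.
have -> : (u + x) t = u t + x t by [].
by rewrite lerDl fun_ge0_at.
Qed.

(* The factor [1 + s] guarantees [sup_norm x <= sup_norm u], so that adding [x]
   leaves the sup norm of [u] unchanged. *)
Definition beside x u : Prop :=
  [/\ X u, fun_le 0 u, u \min x = 0 & (1 + s) * N x <= N u].

(** This expresses [F x] through [N] alone, which makes it accessible to isometries. *)
Lemma beside_increment x u : X x -> fun_le 0 x -> beside x u ->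
  N (u + x) - N u = F x.
Proof.
move=> Xx x0 [Xu u0 ux xu]; have [nx _] := sum_norm_equiv Xx.
have [_ nu] := sum_norm_equiv Xu.
have le_xu : sup_norm x <= sup_norm u.
  rewrite -(@ler_pM2l _ (1 + s)) ?addr_gt0 //.
  apply: le_trans nu; apply: le_trans xu.
  by rewrite ler_wpM2l // addr_ge0 // ltW.
rewrite /N sup_norm_disjoint // total_massD_ge0 //; ring.
Qed.

Lemma beside_shrink x y u : X x -> X y -> fun_le 0 y -> fun_le y x ->
  beside x u -> beside y u.
Proof.
move=> Xx Xy y0 yx [Xu u0 ux xu]; split => //.
  apply/funext => t; suff : Num.min (u t) (y t) = 0 by [].
  apply/le_anti/andP; split.
    have <- := disjoint_at t ux; rewrite le_min ge_min lexx /=.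
    by rewrite ge_min yx orbT.
  by rewrite le_min !fun_ge0_at.
apply: le_trans xu; rewrite ler_wpM2l ?addr_ge0 ?(ltW s0) // sum_norm_mono //.
exact: fun_le_abs.
Qed.
(** For an active [h = f i] the infimum of the admissible [r] is [1 + mass i], by [level_ge] and
    [level_lt]. *)
Definition level h (r : R) : Prop :=
  exists x, [/\ X x, fun_le 0 x, h x = 1 & N x <= r].

(** The increment stands for [F x], written with [N] only so that isometries preserve the notion.
    For [h = f i] the infimum is [mass i] once there are two active indices, by [probe_ge] and
    [probe_lt]. *)
Definition probe h (r : R) : Prop := exists x u,
  [/\ X x, fun_le 0 x, h x = 1, beside x u & N (u + x) - N u <= r].

Lemma level_ge i r : level (f i) r -> 1 + mass i <= r.
Proof.
move=> [x [Xx x0 fx xr]]; apply: le_trans xr; apply: lerD.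
  by have := nh_le nf i Xx; rewrite fx normr1.
by have := mass_le_total i Xx; rewrite fx normr1 mulr1.
Qed.

Lemma probe_ge i r : probe (f i) r -> mass i <= r.
Proof.
move=> [x [u [Xx x0 fx xu xr]]]; rewrite (le_trans _ xr) // beside_increment //.
by have := mass_le_total i Xx; rewrite fx normr1 mulr1.
Qed.

(** After cutting away the first [n] functionals except [f i], what is left of [F] is at most
    [mass i] plus a tail of order [2^-1 ^+ n]. *)
Lemma total_mass_cut i x e : active X (f i) -> X x -> fun_le 0 x -> f i x = 1 ->
  0 < e -> exists y, [/\ X y, fun_le 0 y, fun_le y x, f i y = 1 & F y <= mass i + e].
Proof.
move=> ai Xx x0 fx e0; have nx := sup_norm_ge0 t0 bX Xx.
(* The [+ 1] keeps the denominator positive. *)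
have [n nlt] : exists n, (2^-1 : R) ^+ n < e / (s * (sup_norm x + 1)).
  by apply: exp_half_lt; rewrite divr_gt0 // mulr_gt0 // ltr_wpDl.
have [y [Xy y0 yx fy fky]] : exists y, [/\ X y, fun_le 0 y, fun_le y x,
    f i y = f i x & forall k, (k < n)%N -> k <> i -> f k y = 0].
  apply: (hom_cut_finite hX n hf (hf i) Xx x0) => k ki.
  by have [z [Xz z0 fz fiz]] := nh_sep nf (nesym ki) ai; exists z.
exists y; split => //; first by rewrite fy.
apply: le_trans (total_mass_tail n Xy) _; apply: lerD.
  have fi1 : mass i * `|f i y| = mass i by rewrite fy fx normr1 mulr1.
  rewrite /S; have [ni|ilt] := leqP n i.
    rewrite big1 ?ltW ?mass_gt0 // => k _; rewrite fky ?normr0 ?mulr0 //.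
    by move=> ki; move: (ltn_ord k); rewrite ki ltnNge ni.
  rewrite (bigD1 (Ordinal ilt)) //= fi1 big1 ?addr0 // => k /eqP ki.
  by rewrite fky ?normr0 ?mulr0 // => /esym ki'; apply: ki; apply: val_inj.
have yn : sup_norm y <= sup_norm x.
  by apply: (sup_norm_mono t0 bX Xx); exact: fun_le_abs.
move: nlt; rewrite ltr_pdivlMr; last by rewrite mulr_gt0 // ltr_wpDl.
move=> /ltW; apply: le_trans; rewrite mulrA [_ * s]mulrC.
rewrite ler_wpM2l ?mulr_ge0 ?exp_half_ge0 ?(ltW s0) //; lra.
Qed.

Lemma level_lt i r : active X (f i) -> 1 + mass i < r -> level (f i) r.
Proof.
move=> ai ir; have [p [Xp p0 fp np]] := nh_peak nf ai.
have e0 : 0 < r - (1 + mass i) by rewrite subr_gt0.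
have [y [Xy y0 yp fy Fy]] := total_mass_cut ai Xp p0 fp e0.
exists y; split => //; rewrite /N.
have : sup_norm y <= sup_norm p.
  by apply: (sup_norm_mono t0 bX Xp); exact: fun_le_abs.
lra.
Qed.

(** The remainders of [z] and [v] over [z \min v] are disjoint. The first is normalized at [f i];
    the second is nonzero because [f k] sees it, so a multiple of it is as large as needed. *)
Lemma beside_exists i k : i <> k -> active X (f i) -> active X (f k) ->
  exists x u, [/\ X x, fun_le 0 x, f i x = 1 & beside x u].
Proof.
move=> ik ai ak.
have [z [Xz z0 fkz fiz]] := nh_sep nf ik ai.
have [v [Xv v0 fiv fkv]] := nh_sep nf (nesym ik) ak.
pose x1 := (f i z)^-1 *: (z - (z \min v)); pose u1 := v - (z \min v).
have Xm := sublattice_min hX Xz Xv.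
have Xx1 : X x1 by apply: (sublatticeZ hX); exact: sublatticeB.
have Xu1 : X u1 by exact: sublatticeB.
have fi0 : 0 <= (f i z)^-1 by rewrite invr_ge0 ltW.
have x10 : fun_le 0 x1.
  apply: fun_le0Z => // t; suff : 0 <= z t - Num.min (z t) (v t) by [].
  by rewrite subr_ge0 ge_min lexx.
have u10 : fun_le 0 u1.
  move=> t; suff : 0 <= v t - Num.min (z t) (v t) by [].
  by rewrite subr_ge0 ge_min lexx orbT.
have fx1 : f i x1 = 1.
  rewrite (homZ hX (hf i)) ?(homB hX (hf i)) ?(hom_min (hf i)) //; last exact: sublatticeB.
  by rewrite fiv min_r ?(ltW fiz) // subr0 mulVf // gt_eqF.
have ux1 (b : R) : 0 <= b -> (b *: u1) \min x1 = 0.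
  move=> b0; apply/funext => t.
  suff : Num.min (b * (v t - Num.min (z t) (v t)))
      ((f i z)^-1 * (z t - Num.min (z t) (v t))) = 0 by [].
  have [zv|vz] := leP (z t) (v t).
    by rewrite subrr mulr0 min_r // mulr_ge0 // subr_ge0.
  by rewrite subrr mulr0 min_l // mulr_ge0 // subr_ge0 ltW.
have Nu1 : 0 < N u1.
  apply: lt_le_trans (_ : `|f k u1| <= _).
    rewrite (homB hX (hf k)) // (hom_min (hf k)) // fkz min_l ?(ltW fkv) //.
    by rewrite subr0 normr_gt0 gt_eqF.
  by apply: le_trans (nh_le nf k Xu1) _; case: (sum_norm_equiv Xu1).
have sx1 : 0 <= (1 + s) * N x1.
  by rewrite mulr_ge0 ?sum_norm_ge0 // addr_ge0 // ltW.
pose M := (1 + s) * N x1 / N u1.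
have M0 : 0 <= M by rewrite divr_ge0 // ltW.
exists x1, (M *: u1); split => //; split.
- exact: sublatticeZ.
- exact: fun_le0Z.
- exact: ux1.
- by rewrite sum_normZ // ger0_norm // /M divfK // gt_eqF.
Qed.

Lemma probe_lt i k r : i <> k -> active X (f i) -> active X (f k) ->
  mass i < r -> probe (f i) r.
Proof.
move=> ik ai ak ir; have [x [u [Xx x0 fx xu]]] := beside_exists ik ai ak.
have e0 : 0 < r - mass i by rewrite subr_gt0.
have [y [Xy y0 yx fy Fy]] := total_mass_cut ai Xx x0 fx e0.
have yu := beside_shrink Xx Xy y0 yx xu.
exists y, u; split => //; rewrite beside_increment //; lra.
Qed.

(** If no active [f k] controls [h], all of the first [n] functionals can be cut away without
    changing [h x], which makes [F x] arbitrarily small. *)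
Lemma probe_null h r e : lattice_hom X h -> probe h r ->
  (forall k, active X (f k) -> exists z, [/\ X z, fun_le 0 z, f k z = 0 & 0 < h z]) ->
  0 < e -> probe h e.
Proof.
move=> hh [x [u [Xx x0 hx xu _]]] sep e0; have nx := sup_norm_ge0 t0 bX Xx.
have [n nlt] : exists n, (2^-1 : R) ^+ n < e / (s * (sup_norm x + 1)).
  by apply: exp_half_lt; rewrite divr_gt0 // mulr_gt0 // ltr_wpDl.
have [y [Xy y0 yx hy fy]] := hom_cut_finite hX n hf hh Xx x0 sep.
have yu := beside_shrink Xx Xy y0 yx xu.
exists y, u; split => //; first by rewrite hy.
rewrite beside_increment //; apply: le_trans (total_mass_tail n Xy) _.
rewrite /S big1 ?add0r => [|k _]; last first.
  have [ak|ak] := pselect (active X (f k)); first by rewrite fy ?normr0 ?mulr0.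
  by rewrite (inactive0 ak) ?normr0 ?mulr0.
have yn : sup_norm y <= sup_norm x.
  by apply: (sup_norm_mono t0 bX Xx); exact: fun_le_abs.
move: nlt; rewrite ltr_pdivlMr; last by rewrite mulr_gt0 // ltr_wpDl.
move=> /ltW; apply: le_trans; rewrite mulrA [_ * s]mulrC.
rewrite ler_wpM2l ?mulr_ge0 ?exp_half_ge0 ?(ltW s0) //; lra.
Qed.

Lemma level_scale g h b r : lattice_hom X g -> 0 < b ->
  (forall x, X x -> h x = b * g x) -> level h r -> level g (b * r).
Proof.
move=> hg b0 hE [x [Xx x0 hx xr]]; exists (b *: x); split.
- exact: sublatticeZ.
- exact/fun_le0Z/x0/ltW.
- by rewrite (homZ hX hg) // -hE.
- by rewrite sum_normZ // gtr0_norm // ler_pM2l.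
Qed.

Lemma probe_scale g h b r : lattice_hom X g -> 0 < b ->
  (forall x, X x -> h x = b * g x) -> probe h r -> probe g (b * r).
Proof.
move=> hg b0 hE [x [u [Xx x0 hx [Xu u0 ux xu] xr]]].
exists (b *: x), (b *: u); have bu := sublatticeZ hX b Xu.
have bx := sublatticeZ hX b Xx; split => //.
- exact/fun_le0Z/x0/ltW.
- by rewrite (homZ hX hg) // -hE.
- split => //; first exact/fun_le0Z/u0/ltW.
    apply/funext => t; suff : Num.min (b * u t) (b * x t) = 0 by [].
    by rewrite -minr_pMr ?(ltW b0) // disjoint_at // mulr0.
  by rewrite !sum_normZ // mulrCA ler_wpM2l.
- rewrite -scalerDr !sum_normZ //; last exact: sublatticeD.
  by rewrite -mulrBr gtr0_norm // ler_pM2l.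
Qed.

Section Isometry.
Context {T : (K -> R) -> K -> R} (isoT : lattice_isometry X N T).

Let nN : is_norm X N. Proof. by case: sum_norm_lattice. Qed.

Lemma level_iso h r : level (h \o T) r <-> level h r.
Proof.
split=> [[x [Xx x0 hx xr]]|[y [Xy y0 hy yr]]].
  exists (T x); split => //; first exact: (iso_in isoT).
    by apply/(iso_ge0 hX nN isoT Xx).
  by rewrite (iso_norm isoT).
have [x Xx xy] := iso_onto isoT Xy; subst y; exists x; split => //.
  by apply/(iso_ge0 hX nN isoT Xx).
by rewrite -(iso_norm isoT).
Qed.

Lemma probe_iso h r : probe (h \o T) r <-> probe h r.
Proof.
have incr x u : X x -> X u -> N (T u + T x) = N (u + x).
  move=> Xx Xu; rewrite -(isoD isoT) // (iso_norm isoT) //.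
  exact: sublatticeD.
have disj x u : X x -> X u -> u \min x = 0 <-> T u \min T x = 0.
  move=> Xx Xu; rewrite -(iso_min isoT) //.
  split=> [->|]; first exact: (iso0 hX isoT).
  rewrite -{1}(iso0 hX isoT); apply: (iso_inj hX nN isoT).
    exact: sublattice_min.
  exact: sublattice0.
split=> [[x [u [Xx x0 hx [Xu u0 ux xu] xr]]]|].
  exists (T x), (T u); split.
  - exact: (iso_in isoT).
  - by apply/(iso_ge0 hX nN isoT Xx).
  - by [].
  - split; first exact: (iso_in isoT).
    + by apply/(iso_ge0 hX nN isoT Xu).
    + exact/(disj _ _ Xx Xu).
    + by rewrite !(iso_norm isoT).
  - by rewrite incr // (iso_norm isoT).
move=> [y [v [Xy y0 hy [Xv v0 vy yv] yr]]].
have [x Xx xy] := iso_onto isoT Xy; subst y.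
have [u Xu uv] := iso_onto isoT Xv; subst v.
exists x, u; split => //.
- by apply/(iso_ge0 hX nN isoT Xx).
- split => //.
  + by apply/(iso_ge0 hX nN isoT Xu).
  + exact/(disj _ _ Xx Xu).
  + by rewrite -(iso_norm isoT Xx) -(iso_norm isoT Xu).
- by rewrite -incr // -(iso_norm isoT Xu).
Qed.

End Isometry.

Theorem sum_norm_rigid : (forall i, exists2 k, i <> k & active X (f k)) ->
  only_trivial_lattice_isometry X N.
Proof.
move=> two T isoT x Xx.
apply: (eq_norming hX bX nf) => // [|i ai]; first exact: (iso_in isoT).
have hiT := hom_iso isoT (hf i).
have probeP j r : active X (f j) -> mass j < r -> probe (f j) r.
  by move=> aj; have [j' jj' aj'] := two j; exact: probe_lt aj aj'.
have pi1 : probe (f i \o T) (mass i + 1).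
  by apply/(probe_iso isoT)/probeP => //; rewrite ltrDl.
have [k [ak ker]] : exists k, active X (f k) /\
    forall z, X z -> fun_le 0 z -> f k z = 0 -> (f i \o T) z = 0.
  (* Otherwise [probe_null] and invariance would give [probe (f i)] at [mass i / 2], below the lower
     bound [mass i]. *)
  apply: contrapT => nk.
  have /(probe_null hiT pi1) : forall k, active X (f k) ->
      exists z, [/\ X z, fun_le 0 z, f k z = 0 & 0 < (f i \o T) z].
    move=> k ak; apply: contrapT => nz; apply: nk; exists k; split => // z Xz z0 fz.
    apply: contrapT => /eqP hz; apply: nz; exists z; split => //.
    by rewrite lt_neqAle eq_sym hz (hom_ge0 hX hiT).
  move=> /(_ (mass i / 2)); have mi := mass_gt0 i.
  have mi2 : 0 < mass i / 2 by lra.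
  by move=> /(_ mi2) /(probe_iso isoT) /probe_ge; lra.
have [p [Xp p0 fp _]] := nh_peak nf ak.
have hE := hom_proportional hX (hf k) hiT Xp fp ker.
set b := (f i \o T) p in hE.
have b0 : 0 < b.
  rewrite lt_neqAle (hom_ge0 hX hiT) // andbT; apply/eqP => b0.
  case: pi1 => y [u [Xy _ + _ _]]; rewrite hE // -b0 mul0r => /eqP.
  by rewrite eq_sym oner_eq0.
have hE' y : X y -> f k y = b^-1 * (f i \o T) y.
  by move=> Xy; rewrite hE // mulKf // gt_eqF.
have bV0 : 0 < b^-1 by rewrite invr_gt0.
(* The infimum of [probe] is [mass k] for [f k] and, by invariance, [mass i] for [f i \o T]; the
   scaling lemma, used with [b] and with [b^-1], relates the two. *)
have massE : b * mass i = mass k.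
  apply/le_anti/andP; split; apply/ler_addgt0Pr => e e0.
    rewrite -ler_pdivlMl //; apply: probe_ge; apply/(probe_iso isoT).
    by apply: (probe_scale hiT bV0 hE'); apply: probeP => //; rewrite ltrDl.
  have eb0 : 0 < b^-1 * e by exact: mulr_gt0.
  have : mass k <= b * (mass i + b^-1 * e).
    apply: probe_ge; apply: (probe_scale (hf k) b0 hE).
    by apply/(probe_iso isoT)/probeP => //; rewrite ltrDl.
  by rewrite mulrDr mulVKf // gt_eqF.
have normE : b * (1 + mass i) = 1 + mass k.
  apply/le_anti/andP; split; apply/ler_addgt0Pr => e e0.
    rewrite -ler_pdivlMl //; apply: level_ge; apply/(level_iso isoT).
    by apply: (level_scale hiT bV0 hE'); apply: level_lt => //; rewrite ltrDl.
  have eb0 : 0 < b^-1 * e by exact: mulr_gt0.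
  have : 1 + mass k <= b * (1 + mass i + b^-1 * e).
    apply: level_ge; apply: (level_scale (hf k) b0 hE).
    by apply/(level_iso isoT)/level_lt => //; rewrite ltrDl.
  by rewrite mulrDr mulVKf // gt_eqF.
have b1 : b = 1 by move: normE; rewrite mulrDr massE mulr1; lra.
have ik : k = i by apply: mass_inj; rewrite -massE b1 mul1r.
by have := hE x Xx; rewrite /= b1 mul1r ik.
Qed.

End SumNorm.
Arguments sum_norm {R K} f s x.

(** * Atoms and functionals with isolation 0 *)

Section Atoms.
Context {R : realType} {K : Type} {X : set (K -> R)} (hX : vector_sublattice X).
Context (bX : forall x, X x -> exists M : R, forall t, `|x t| <= M).
Context {f : nat -> (K -> R) -> R} (nf : norming_homs X f).
Implicit Types (x y z e : K -> R).

Let hf := nh_hom nf.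

(** The single functional [f i] determines the elements of [X], which therefore has dimension at
    most one. *)
Lemma single_active_atom i : (forall k, active X (f k) -> k = i) ->
  at_most_one_atom X.
Proof.
move=> only e e' [Xe e0 ne _] [Xe' e'0 ne' _].
have pos x : X x -> fun_le 0 x -> x <> 0 -> 0 < f i x.
  move=> Xx x0 nx; rewrite lt_neqAle (hom_ge0 hX (hf i)) // andbT eq_sym.
  apply/eqP => fx; apply: nx; apply: (eq_norming hX bX nf Xx (sublattice0 hX)).
  by move=> k /only ->; rewrite fx (hom0 hX (hf i)).
have fe := pos e Xe e0 ne; have fe' := pos e' Xe' e'0 ne'.
exists (f i e' / f i e); first exact: divr_gt0.
have XZ := sublatticeZ hX (f i e' / f i e) Xe.
apply: (eq_norming hX bX nf Xe' XZ) => k /only ->.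
by rewrite (homZ hX (hf i)) // divfK // gt_eqF.
Qed.

(** In the coordinates [f j], which determine the elements of [X], [e] is the unit vector at [i];
    its positivity and its minimality are read off there. *)
Lemma isolated_atom i e : X e -> f i e = 1 -> (forall j, j <> i -> f j e = 0) ->
  atom X e.
Proof.
move=> Xe fe fje; have e0 : fun_le 0 e.
  have -> : e = fun_abs e; last exact: fun_abs_ge0.
  apply: (eq_norming hX bX nf Xe (sublattice_abs hX Xe)) => j _.
  rewrite (hom_abs hX (hf j)) //.
  by have [->|/eqP /fje ->] := eqVneq j i; rewrite ?fe ?normr1 ?normr0.
split=> // [e00|x Xx x0 xe].
  by move: fe; rewrite e00 (hom0 hX (hf i)) => /eqP; rewrite eq_sym oner_eq0.
exists (f i x); apply: (eq_norming hX bX nf Xx (sublatticeZ hX _ Xe)) => j _.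
rewrite (homZ hX (hf j)) //.
have [->|/eqP /fje fj] := eqVneq j i; first by rewrite fe mulr1.
rewrite fj mulr0; apply/le_anti; rewrite (hom_ge0 hX (hf j)) // andbT -fj.
exact: (hom_le (hf j)).
Qed.

(** Elements isolating [f i] up to [2^-1 ^+ n] agree at [f i] and are small at every other [f j], so
    they form a Cauchy sequence, whose limit is isolated exactly. *)
Lemma isolation0_atom i :
  (forall u : nat -> K -> R, (forall n, X (u n)) ->
     (forall m n, sup_norm (u m - u n) <= 2^-1 ^+ m + 2^-1 ^+ n) ->
     exists2 e, X e & forall n, sup_norm (e - u n) <= 2^-1 ^+ n) ->
  active X (f i) -> isolation X f i = 0 ->
  exists e, [/\ atom X e, f i e = 1 & forall j, j <> i -> f j e = 0].
Proof.
move=> complete ai iso0.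
have /choice[u uP] n : exists x, isolating X f i (2^-1 ^+ n) x.
  by apply: (isolation_lt nf ai); rewrite iso0 exprn_gt0.
have Xu n : X (u n) by case: (uP n).
have fu n : f i (u n) = 1 by case: (uP n).
have fju n j : j <> i -> 0 <= f j (u n) <= 2^-1 ^+ n.
  by case: (uP n) => _ u0 _ uj ji; rewrite uj // (hom_ge0 hX (hf j)).
have [m n|e Xe eu] := complete u Xu.
  have XB := sublatticeB hX (Xu m) (Xu n).
  have em := @exp_half_ge0 R m; have en := @exp_half_ge0 R n.
  apply: (nh_norm nf XB) => [|j]; first exact: addr_ge0.
  rewrite (homB hX (hf j)) //; have [->|/eqP ji] := eqVneq j i.
    by rewrite !fu subrr normr0 addr_ge0.
  by move: (fju m j ji) (fju n j ji); rewrite ler_norml; lra.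
have small (a : R) : 0 <= a -> (forall n, a <= 2 * 2^-1 ^+ n) -> a = 0.
  move=> a0 an; apply/le_anti; rewrite a0 andbT; apply/ler_addgt0Pr => d d0.
  have d2 : 0 < d / 2 by lra.
  by have [n] := exp_half_lt d2; have := an n; lra.
have feu n j : `|f j e - f j (u n)| <= 2^-1 ^+ n.
  rewrite -(homB hX (hf j)) //.
  by apply: le_trans (eu n); apply: (nh_le nf); exact: sublatticeB.
have fe : f i e = 1.
  apply/eqP; rewrite -subr_eq0 -normr_eq0; apply/eqP/small => // n.
  by have := feu n i; have := @exp_half_ge0 R n; rewrite fu; lra.
have fje j : j <> i -> f j e = 0.
  move=> ji; apply/normr0_eq0/small => // n; move: (fju n j ji) (feu n j).
  by rewrite !ler_norml; lra.
by exists e; split => //; exact: isolated_atom fe fje.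
Qed.

End Atoms.

(** * Norming homomorphisms on a compact space *)

Section CompactSpace.
Context {R : realType} {K : topologicalType} {X : set (K -> R)}.
Context (t0 : K) (cK : compact [set: K]) (cX : closed_sublattice_of_C X).
Implicit Types (x y z : K -> R).

Let hX : vector_sublattice X. Proof. by case: cX. Qed.

Lemma compact_norm_max x : X x -> exists t, forall s, `|x s| <= `|x t|.
Proof.
move=> Xx; have cx : continuous (fun t => `|x t|).
  by move=> t; apply: cvg_norm; case: cX => /(_ x Xx) + _ _; exact.
have K0 : [set: K] !=set0 by exists t0.
have [t _ tP] := compact_EVT_max K0 cK (continuous_subspaceT cx).
by exists t => s; apply: tP; rewrite in_setT.
Qed.

Lemma compact_bounded_fun x : X x -> exists M : R, forall t, `|x t| <= M.
Proof. by move=> /compact_norm_max[t tP]; exists `|x t|. Qed.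

Lemma closed_sublattice_complete (u : nat -> K -> R) : (forall n, X (u n)) ->
  (forall m n, sup_norm (u m - u n) <= 2^-1 ^+ m + 2^-1 ^+ n) ->
  exists2 e, X e & forall n, sup_norm (e - u n) <= 2^-1 ^+ n.
Proof.
move=> Xu cu; pose q n : R := 2^-1 ^+ n.
have cut m n t : u m t - q m <= u n t + q n.
  have := ler_sup_norm compact_bounded_fun t (sublatticeB hX (Xu m) (Xu n)).
  have -> : (u m - u n) t = u m t - u n t by [].
  move=> /le_trans /(_ (cu m n)); rewrite ler_norml /q; lra.
(* By [cut], the intervals of radius [q n] around [u n t] pairwise meet; the infimum of their right
   ends lies in all of them. *)
pose e t := inf [set u n t + q n | n in [set: nat]].
have lbe m t : lbound [set u n t + q n | n in [set: nat]] (u m t - q m).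
  by move=> _ [n _ <-].
have eu n t : `|e t - u n t| <= q n.
  have e1 : u n t - q n <= e t by apply: lb_le_inf => //; exists (u n t + q n), n.
  have e2 : e t <= u n t + q n by apply: ge_inf; [exists (u n t - q n)|exists n].
  rewrite ler_norml; lra.
have ceu n : sup_norm (e - u n) <= q n.
  by apply: (sup_norm_ler t0) => t; exact: eu.
exists e => //; case: cX => cont _; apply; last first.
  by move=> d d0; have [n nd] := exp_half_lt d0; exists (u n) => //; exact: le_lt_trans nd.
(* A uniform limit of continuous functions is continuous. *)
move=> t; apply/cvgrPdist_lt => d d0.
have [n nd] : exists n, q n < d / 3 by apply: exp_half_lt; lra.
have /cvgrPdist_lt/(_ (d / 3)) := cont (u n) (Xu n) t.
have d3 : 0 < d / 3 by lra.
move=> /(_ d3); apply: filterS => r ur.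
move: (eu n t) (eu n r) ur; rewrite ler_norml ler_norml !ltr_norml; lra.
Qed.

Context (sepX : separable X sup_norm).

Lemma separable_seq : exists2 g : nat -> K -> R, forall n, X (g n) &
  forall x d, X x -> 0 < d -> exists n, sup_norm (x - g n) < d.
Proof.
case: sepX => D [/countable_injP[c cinj] DX XD].
(* Indices outside the range of [c] on [D] receive the default 0, which belongs to [X]. *)
pose g n := xget 0 [set y | D y /\ c y = n].
exists g => [n|x d Xx d0].
  rewrite /g; case: xgetP => [y _ [/DX //]|_]; exact: sublattice0.
have [y Dy xy] := XD x Xx d d0; exists (c y); rewrite /g.
case: xgetP => [z _ [Dz cz]|/(_ y)]; last by case.
by rewrite (cinj z y) ?inE.
Qed.

Lemma exists_norming_homs : exists f, norming_homs X f.
Proof.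
have bX := compact_bounded_fun.
have [g Xg gd] := separable_seq.
have /choice[t tP] n : exists t, forall s, `|g n s| <= `|g n t|.
  exact: compact_norm_max.
have gn n : sup_norm (g n) = `|g n (t n)|.
  apply/le_anti; rewrite (ler_sup_norm bX) // andbT.
  exact: (sup_norm_ler t0).
(* Select [n] when [g n] is nonzero and evaluation at [t n] differs on [X] from evaluation at every
   earlier [t m] with [g m] nonzero. *)
pose sel n := 0 < sup_norm (g n) /\ forall m, (m < n)%N ->
  0 < sup_norm (g m) -> exists2 x, X x & x (t m) <> x (t n).
pose f n x := if `[< sel n >] then x (t n) else 0.
have selE n x : sel n -> f n x = x (t n) by move=> sn; rewrite /f asboolT.
have hf n : lattice_hom X (f n).
  rewrite /f; case: asboolP => _.
    by split=> [a x y _ _|x y _ _|x y _ _].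
  by split=> [a x y _ _|x y _ _|x y _ _]; rewrite ?mulr0 ?addr0 ?maxxx ?minxx.
have act_sel n : active X (f n) -> sel n.
  by move=> [x _]; rewrite /f; case: asboolP.
have peak n : sel n -> exists p, [/\ X p, fun_le 0 p, p (t n) = 1 & forall s, p s <= 1].
  move=> [gn0 _]; have XA := sublattice_abs hX (Xg n).
  have gV : 0 <= (sup_norm (g n))^-1 by rewrite invr_ge0 ltW.
  have pE s : ((sup_norm (g n))^-1 *: fun_abs (g n)) s = (sup_norm (g n))^-1 * `|g n s| by [].
  exists ((sup_norm (g n))^-1 *: fun_abs (g n)); split.
  - exact: sublatticeZ.
  - exact/(fun_le0Z gV)/fun_abs_ge0.
  - by rewrite pE -gn mulVf // gt_eqF.
  - by move=> s; rewrite pE ler_pdivrMl // mulr1 (ler_sup_norm bX).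
exists f; split => //.
- move=> i x Xx; rewrite /f; case: asboolP => _; first exact: (ler_sup_norm bX).
  by rewrite normr0 (sup_norm_ge0 t0 bX).
- move=> x M Xx M0 xM; apply/ler_addgt0Pr => d d0.
  have d2 : 0 < d / 2 by lra.
  have [n xn] := gd x _ Xx d2.
  have XB := sublatticeB hX Xx (Xg n).
  have nD : sup_norm x <= sup_norm (x - g n) + sup_norm (g n).
    by rewrite -{1}(subrK (g n) x) (sup_normD t0 bX).
  have [gn0|gn0] := leP (sup_norm (g n)) 0; first by lra.
  (* The least index giving the same evaluation as [t n] is selected. *)
  have [m [sm mE]] : exists m, sel m /\ forall y, X y -> y (t m) = y (t n).
    have ex : exists m, `[< 0 < sup_norm (g m) /\ forall y, X y -> y (t m) = y (t n) >].
      by exists n; apply/asboolP.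
    case: (ex_minnP ex) => m /asboolP[gm0 mE] mmin; exists m; split => //.
    split => // l lm gl0; apply: contrapT => nl.
    move: lm; rewrite ltnNge => /negP; apply; apply: mmin; apply/asboolP.
    split => // y Xy; rewrite -mE //; apply: contrapT => yl; apply: nl.
    by exists y.
  have := xM m; rewrite selE // mE //.
  have := ler_sup_norm bX (t n) XB.
  have -> : (x - g n) (t n) = x (t n) - g n (t n) by [].
  move: nD; rewrite gn; have := ler_normD (x (t n)) (g n (t n) - x (t n)).
  rewrite addrC subrK [`|g n _ - _|]distrC; lra.
- move=> i /act_sel si; have [p [Xp p0 pt p1]] := peak i si.
  exists p; split => //; first by rewrite selE.
  by apply: (sup_norm_ler t0) => s; rewrite ger0_norm //; exact: p0.
- move=> i j ij /act_sel si; have [p [Xp p0 pt p1]] := peak i si.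
  have [sj|nsj] := pselect (sel j); last first.
    exists p; rewrite (selE i) // pt; split => //.
    by rewrite /f asboolF.
  have [x Xx xij] : exists2 x, X x & x (t i) <> x (t j).
    have [ilj|jli|//] := ltngtP i j.
      by case: sj => _ /(_ i ilj); apply; case: si.
    by case: si => _ /(_ j jli) []; [case: sj|move=> x Xx xij; exists x => //; exact: nesym].
  (* The positive or the negative part of [x] already distinguishes the two points. *)
  have [z [Xz z0 zij]] : exists z, [/\ X z, fun_le 0 z & z (t i) <> z (t j)].
    have Xm := sublattice_max hX Xx (sublattice0 hX).
    have Xn := sublattice_max hX (sublatticeN hX Xx) (sublattice0 hX).
    have ge0 y : fun_le 0 (y \max 0).
      by move=> s; suff : 0 <= Num.max (y s) 0 by []; rewrite le_max lexx orbT.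
    have [E|nE] := pselect (Num.max (x (t i)) 0 = Num.max (x (t j)) 0); last first.
      by exists (x \max 0).
    exists ((- x) \max 0); split => //.
    suff : Num.max (- x (t i)) 0 <> Num.max (- x (t j)) 0 by [].
    move: E; rewrite /Order.max; do 4 case: ifP => ?; lra.
  have [p' [Xp' p'0 p't p'1]] := peak j sj.
  have p0i : 0 <= p (t j) <= 1 by rewrite p1 andbT; exact: p0.
  have p'0i : 0 <= p' (t i) <= 1 by rewrite p'1 andbT; exact: p'0.
  have zi : 0 <= z (t i) by exact: z0.
  have zj : 0 <= z (t j) by exact: z0.
  (* Distinct evaluations are not proportional, as both reach 1 on elements bounded by 1. If [z] is
     larger at [t i], subtract a multiple of [p'], whose value there is at most 1; otherwise
     subtract [p (t j) *: z] from a multiple of [p]. *)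
  have [y [Xy yj yi]] : exists y, [/\ X y, y (t j) = 0 & 0 < y (t i)].
    have [zl|zl] := leP (z (t j)) (z (t i)).
      have zl' : z (t j) < z (t i) by rewrite lt_neqAle zl andbT; apply/eqP/nesym.
      exists (z - z (t j) *: p'); split.
      - by apply: sublatticeB => //; exact: sublatticeZ.
      - have -> : (z - z (t j) *: p') (t j) = z (t j) - z (t j) * p' (t j) by [].
        by rewrite p't mulr1 subrr.
      - have -> : (z - z (t j) *: p') (t i) = z (t i) - z (t j) * p' (t i) by [].
        nra.
    exists (z (t j) *: p - p (t j) *: z); split.
    - by apply: sublatticeB => //; exact: sublatticeZ.
    - have -> : (z (t j) *: p - p (t j) *: z) (t j) =
          z (t j) * p (t j) - p (t j) * z (t j) by [].
      by rewrite mulrC subrr.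
    - have -> : (z (t j) *: p - p (t j) *: z) (t i) =
          z (t j) * p (t i) - p (t j) * z (t i) by [].
      rewrite pt; nra.
  exists (fun_abs y); rewrite !selE //; split.
  + exact: sublattice_abs.
  + exact: fun_abs_ge0.
  + by rewrite /fun_abs yj normr0.
  + by rewrite /fun_abs normr_gt0 gt_eqF.
Qed.

(** * The two rigid renormings *)

Theorem exists_rigid_AM_norm (s : R) : 0 < s -> at_most_one_atom X ->
  exists N : (K -> R) -> R,
  [/\ is_AM_norm X N,
      forall x, X x -> sup_norm x <= N x /\ N x <= (1 + s) * sup_norm x
    & only_trivial_lattice_isometry X N].
Proof.
move=> s0 atom1; have bX := compact_bounded_fun.
have [f nf] := exists_norming_homs.
have [th /andP[th0 ths] gen] := exists_generic_scale (isolation X f) s0.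
pose w := geo_weight th.
have w1 i : 1 <= w i by apply/ltW/geo_weight_gt1.
have wW i : w i <= 1 + s by apply: le_trans (geo_weight_le th0 i) _; rewrite lerD2l ltW.
exists (weighted_sup f w); split.
- exact: (weighted_sup_AM hX bX nf w1 wW).
- by move=> x Xx; exact: (weighted_sup_equiv nf w1 wW).
- apply: (weighted_sup_rigid hX bX nf th0) => i k ai ak ik.
  (* Genericity settles every pair except one with both isolations 0; such a pair would produce two
     atoms that are not proportional. *)
  have [i0|i0] := eqVneq (isolation X f i) 0; last exact: gen.
  have [k0|k0] := eqVneq (isolation X f k) 0; last first.
    by apply/nesym/gen => //; exact: nesym.
  have [e [ae fe _]] := isolation0_atom hX bX nf closed_sublattice_complete ai i0.
  have [e' [ae' _ fe']] := isolation0_atom hX bX nf closed_sublattice_complete ak k0.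
  have [a a0 eE] := atom1 e' e ae' ae.
  have Xe' : X e' by case: ae'.
  move: fe; rewrite eE (homZ hX (nh_hom nf i)) // fe' // mulr0 => /eqP.
  by rewrite eq_sym oner_eq0.
Qed.

Theorem exists_rigid_lattice_norm (s : R) : 0 < s ->
  exists N : (K -> R) -> R,
  [/\ is_lattice_norm X N,
      forall x, X x -> sup_norm x <= N x /\ N x <= (1 + s) * sup_norm x
    & only_trivial_lattice_isometry X N].
Proof.
move=> s0; have bX := compact_bounded_fun.
have [f nf] := exists_norming_homs.
(* With fewer than two active functionals no disjoint [u] is available for [probe]; then there is at
   most one atom and the AM norm serves. *)
have [two|nt] := pselect (forall i, exists2 k, i <> k & active X (f k)).
  exists (sum_norm f s); split.
  - exact: (sum_norm_lattice hX t0 bX nf s0).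
  - by move=> x Xx; exact: (sum_norm_equiv t0 bX nf s0).
  - exact: (sum_norm_rigid hX t0 bX nf s0).
have [i only] : exists i, forall k, active X (f k) -> k = i.
  apply: contrapT => ni; apply: nt => i; apply: contrapT => nk; apply: ni.
  by exists i => k ak; apply: contrapT => ki; apply: nk; exists k => //; exact: nesym.
have [N [[LN _] ? ?]] := exists_rigid_AM_norm s0 (single_active_atom hX bX nf only).
by exists N.
Qed.

End CompactSpace.

Theorem theorem3p1 (R : realType) (K_ : nat -> topologicalType)
    (X : set (benyamini_compactum K_ -> R))
    (X_Benyamini : Benyamini X) (X_separable : separable X sup_norm)
    (c : R) (c_gt1 : 1 < c) :
  (exists N : (benyamini_compactum K_ -> R) -> R,
    [/\ is_lattice_norm X N,
        forall x, X x -> sup_norm x <= N x /\ N x <= c ^+ 2 * sup_norm x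
      & only_trivial_lattice_isometry X N]) /\
  (at_most_one_atom X ->
    exists N : (benyamini_compactum K_ -> R) -> R,
    [/\ is_AM_norm X N,
        forall x, X x -> sup_norm x <= N x /\ N x <= c ^+ 2 * sup_norm x
      & only_trivial_lattice_isometry X N]).
Proof.
have cX : closed_sublattice_of_C X by case: X_Benyamini => C _ [].
have cK : compact [set: benyamini_compactum K_] := one_point_compactification_compact.
(* Both constructions lose a factor [1 + s]; the choice [s = c ^+ 2 - 1] turns it into [c ^+ 2]. *)
have s0 : 0 < c ^+ 2 - 1 by rewrite subr_gt0 exprn_egt1.
rewrite -[c ^+ 2](subrK 1) [_ + 1]addrC; split=> [|atom1].
  exact: (exists_rigid_lattice_norm (infty K_) cK cX X_separable s0).
exact: (exists_rigid_AM_norm (infty K_) cK cX X_separable s0 atom1).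
Qed.
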